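(* Consider ALPC-SVRG for the general convex case (defined in the context), with each $f_i$ convex, $h$ convex, and $x^*$ a minimizer of $P$. Let $d_\lambda\ge0$ be such that almost surely, at every iteration and for every worker $i$, the number of coordinates of $u_{k+1}^i$ lying outside $[-2^{b-1}\delta_{k+1}^i,(2^{b-1}-1)\delta_{k+1}^i]$ is at most $d_\lambda$, let $\zeta=\frac{d\lambda^2}{4(2^{b-1}-1)^2}+d_\lambda(1-\lambda)^2+\frac{1}{NB}$, and suppose $\tau_2=\frac{5\zeta}{3}+\frac1{2B}\le\frac12$. Then there is an absolute constant $C>0$ such that $$\mathbf{E}\big[P(\tilde x^S)-P(x^* )\big]\le\frac{C}{mS^2}\Big[m\big(P(x_0)-P(x^* )\big)+L\|x_0-x^*\|^2\Big].$$
   Context: Problem setting: $f_1,\dots,f_n:\mathbb{R}^d\to\mathbb{R}$ are differentiable with $\|\nabla f_i(x)-\nabla f_i(y)\|\le L\|x-y\|$; $f=\frac1n\sum_if_i$; $h:\mathbb{R}^d\to\mathbb{R}\cup\{+\infty\}$ proper, convex, lower semicontinuous; $P=f+h$. Quantization: for an integer $b\ge2$ and $\delta>0$, $\mathrm{dom}(\delta,b)=\{k\delta:k\in\mathbb{Z},-2^{b-1}\le k\le 2^{b-1}-1\}$; the scalar quantizer $Q_{(\delta,b)}(y)$, for $y\in[-2^{b-1}\delta,(2^{b-1}-1)\delta]$ with $z$ the largest grid point $\le y$, equals $z$ with probability $\frac{z+\delta-y}{\delta}$ and $z+\delta$ otherwise; for $y$ outside this interval it equals the nearest grid point; on vectors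 it acts coordinatewise with independent randomness; if $\delta=0$ the output is $0$. ALPC-SVRG (general convex case) with $N$ workers, parameters $S,m,B\in\mathbb{N}$, $\lambda\in(0,1]$, $b\ge2$, $\tau_2\in[0,\frac12]$, and $x_0=y_0=z_0=\tilde x^0$: for $s=0,\dots,S-1$, set $\tau_{1,s}=\frac{2}{s+4}$, $\alpha_s=\frac{1}{6L\tau_{1,s}}$, and compute $\nabla f(\tilde x^s)$ exactly; for $t=0,\dots,m-1$, with $k=sm+t$: set $x_{k+1}=\tau_{1,s}z_k+\tau_2\tilde x^s+(1-\tau_{1,s}-\tau_2)y_k$; each worker $i$ draws $B$ indices independently and uniformly from $\{1,\dots,n\}$ (independently across workers and iterations), forming $I^i_{k+1}$, computes $u_{k+1}^i=\frac1B\sum_{a\in I^i_{k+1}}[\nabla f_a(x_{k+1})-\nabla f_a(\tilde x^s)]$ and $\delta_{k+1}^i=\frac{\lambda\|u_{k+1}^i\|_\infty}{2^{b-1}-1}$; set $v_{k+1}=\frac1N\sum_iQ_{(\delta^i_{k+1},b)}(u^i_{k+1})+\nabla f(\tilde x^s)$; draw an additional multiset $J_{k+1}$ of $B$ indices uniformly and independently from $\{1,\dots,n\}$, independent of everything else (the same for all workers), and set $\hat v_{k+1}=\frac1B\sum_{j\in J_{k+1}}[\nabla f_j(x_{k+1})-\nabla f_j(\tilde x^s)]+\nabla f(\tilde x^s)$; then $y_{k+1}=\arg\min_y\{2L\|y-x_{k+1}\|^2+\langle v_{k+1},y\rangle+h(y)\}$ and $z_{k+1}=\arg\min_z\{\frac1{2\alpha_s}\|z-z_k\|^2+\langle\hat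 v_{k+1},z\rangle+h(z)\}$. After the inner loop, $\tilde x^{s+1}=\frac1m\sum_{t=1}^m y_{sm+t}$. Output $\tilde x^S$. *)

(* Defs.v *)
From Stdlib Require Import Reals.
From mathcomp Require Import ssreflect ssrfun ssrbool eqtype ssrnat seq choice fintype bigop.
Set Implicit Arguments. Unset Strict Implicit.
Open Scope R_scope.

Definition vec (d : nat) := 'I_d -> R.
Definition vadd d (x y : vec d) : vec d := fun j => x j + y j.
Definition vsub d (x y : vec d) : vec d := fun j => x j - y j.
Definition vscale d (a : R) (x : vec d) : vec d := fun j => a * x j.
Definition vzero d : vec d := fun _ => 0.
Definition dot d (x y : vec d) : R := \big[Rplus/0]_(j < d) (x j * y j).
Definition norm d (x : vec d) : R := sqrt (dot x x).
Definition norm_inf d (x : vec d) : R := \big[Rmax/0]_(j < d) Rabs (x j).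
Definition vsum d (I : Type) (s : seq I) (F : I -> vec d) : vec d :=
  fun j => \big[Rplus/0]_(i <- s) F i j.

Definition is_gradient d (f : vec d -> R) (g : vec d -> vec d) : Prop :=
  forall x eps, 0 < eps -> exists del, 0 < del /\
    forall hv : vec d, norm hv < del ->
      Rabs (f (vadd x hv) - f x - dot (g x) hv) <= eps * norm hv.

Definition convex_fun d (f : vec d -> R) : Prop :=
  forall x y t, 0 <= t <= 1 ->
    f (vadd (vscale t x) (vscale (1 - t) y)) <= t * f x + (1 - t) * f y.

(* extended-real valued functions: None = +infinity *)
Definition ereal := option R.

Definition proper_ext d (h : vec d -> ereal) : Prop := exists x a, h x = Some a.

Definition convex_ext d (h : vec d -> ereal) : Prop :=
  forall x y t a c, 0 <= t <= 1 -> h x = Some a -> h y = Some c ->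
    exists e, h (vadd (vscale t x) (vscale (1 - t) y)) = Some e /\ e <= t * a + (1 - t) * c.

Definition ereal_gt (e : ereal) (r : R) : Prop :=
  match e with None => True | Some a => r < a end.

Definition lsc_ext d (h : vec d -> ereal) : Prop :=
  forall x r, ereal_gt (h x) r -> exists del, 0 < del /\
    forall y, norm (vsub y x) < del -> ereal_gt (h y) r.

Definition is_prox d (h : vec d -> ereal) (prox : R -> vec d -> vec d -> vec d) : Prop :=
  forall c x v, 0 < c -> exists hp, h (prox c x v) = Some hp /\
    forall y hy, h y = Some hy ->
      c * norm (vsub (prox c x v) x) ^ 2 + dot v (prox c x v) + hp
      <= c * norm (vsub y x) ^ 2 + dot v y + hy.

Definition dist (A : Type) := seq (R * A).
Definition dret A (a : A) : dist A := [:: (1, a)].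
Definition dbind A B (m : dist A) (k : A -> dist B) : dist B :=
  flatten (map (fun pa => map (fun qb => (pa.1 * qb.1, qb.2)) (k pa.2)) m).
Definition duniform n : dist 'I_n := map (fun i => (/ INR n, i)) (enum 'I_n).
Fixpoint dseq A (l : seq (dist A)) : dist (seq A) :=
  match l with
  | [::] => dret [::]
  | m :: l' => dbind m (fun a => dbind (dseq l') (fun r => dret (a :: r)))
  end.
Definition diid A (k : nat) (m : dist A) : dist (seq A) := dseq (nseq k m).
Definition expect A (m : dist A) (F : A -> R) : R :=
  \big[Rplus/0]_(pa <- m) (pa.1 * F pa.2).
Definition almost_surely A (m : dist A) (Q : A -> Prop) : Prop :=
  forall pa, List.In pa m -> 0 < pa.1 -> Q pa.2.
Fixpoint drepeat A (k : nat) (f : A -> dist A) (a : A) : dist A :=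
  match k with 0 => dret a | k'.+1 => dbind (f a) (drepeat k' f) end.

Definition grid_lo (delta : R) (b : nat) : R := - (2 ^ (b.-1)) * delta.
Definition grid_hi (delta : R) (b : nat) : R := (2 ^ (b.-1) - 1) * delta.

Definition quant_scalar (delta : R) (b : nat) (y : R) : dist R :=
  if Req_EM_T delta 0 then dret 0 else
  if Rlt_dec y (grid_lo delta b) then dret (grid_lo delta b) else
  if Rlt_dec (grid_hi delta b) y then dret (grid_hi delta b) else
  let z := delta * IZR (Int_part (y / delta)) in
  [:: ((z + delta - y) / delta, z); ((y - z) / delta, z + delta)].

Definition quant_vec d (delta : R) (b : nat) (u : vec d) : dist (vec d) :=
  dbind (dseq (map (fun j => quant_scalar delta b (u j)) (enum 'I_d)))
        (fun l => dret (fun j : 'I_d => nth 0 l j)).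

Definition n_out d (delta : R) (b : nat) (u : vec d) : nat :=
  count (fun j : 'I_d =>
           if Rlt_dec (u j) (grid_lo delta b) then true
           else if Rlt_dec (grid_hi delta b) (u j) then true else false)
        (enum 'I_d).

Section ALPC.
Variables (d n N : nat) (gs : 'I_n -> vec d -> vec d)
  (prox : R -> vec d -> vec d -> vec d)
  (L lam tau2 dlam : R) (b B m : nat).

Definition full_grad (x : vec d) : vec d :=
  vscale (/ INR n) (vsum (enum 'I_n) (fun a => gs a x)).

Definition batch_diff (I : seq 'I_n) (x xt : vec d) : vec d :=
  vscale (/ INR B) (vsum I (fun a => vsub (gs a x) (gs a xt))).

Definition worker (x xt : vec d) : dist (vec d * bool) :=
  dbind (diid B (duniform n)) (fun I =>
    let u := batch_diff I x xt in
    let del := lam * norm_inf u / (2 ^ (b.-1) - 1) in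
    dbind (quant_vec del b u) (fun q =>
      dret (q, if Rle_dec (INR (n_out del b u)) dlam then true else false))).

Definition inner_step (s : nat) (xt : vec d)
    (st : vec d * vec d * vec d * bool) : dist (vec d * vec d * vec d * bool) :=
  let '(y, z, ys, fl) := st in
  let tau1 := 2 / (INR s + 4) in
  let alpha := 1 / (6 * L * tau1) in
  let gt := full_grad xt in
  let x := vadd (vadd (vscale tau1 z) (vscale tau2 xt)) (vscale (1 - tau1 - tau2) y) in
  dbind (dseq (map (fun _ : 'I_N => worker x xt) (enum 'I_N))) (fun ws =>
  dbind (diid B (duniform n)) (fun J =>
    let v := vadd (vscale (/ INR N) (vsum ws (fun w => w.1))) gt in
    let vh := vadd (batch_diff J x xt) gt in
    let y' := prox (2 * L) x v in
    let z' := prox (1 / (2 * alpha)) z vh in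
    dret (y', z', vadd ys y', fl && all (fun w => w.2) ws))).

Definition epoch (s : nat) (st : vec d * vec d * vec d * bool)
    : dist (vec d * vec d * vec d * bool) :=
  let '(xt, y, z, fl) := st in
  dbind (drepeat m (inner_step s xt) (y, z, @vzero d, fl)) (fun st' =>
    let '(y', z', ys, fl') := st' in
    dret (vscale (/ INR m) ys, y', z', fl')).

Fixpoint outer (s k : nat) (st : vec d * vec d * vec d * bool)
    : dist (vec d * vec d * vec d * bool) :=
  match k with
  | 0 => dret st
  | k'.+1 => dbind (epoch s st) (outer s.+1 k')
  end.

Definition alpc_svrg (S : nat) (x0 : vec d) : dist (vec d * vec d * vec d * bool) :=
  outer 0 S (x0, x0, x0, true).

End ALPC.

Definition out_x d (st : vec d * vec d * vec d * bool) : vec d :=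
  let '(xt, _, _, _) := st in xt.
Definition out_flag d (st : vec d * vec d * vec d * bool) : bool :=
  let '(_, _, _, fl) := st in fl.

Definition favg d n (fs : 'I_n -> vec d -> R) (x : vec d) : R :=
  / INR n * \big[Rplus/0]_(i < n) fs i x.
Definition Pext d n (fs : 'I_n -> vec d -> R) (h : vec d -> ereal) (x : vec d) : ereal :=
  match h x with Some a => Some (favg fs x + a) | None => None end.
(* real value of P, used where P is known to be finite *)
Definition Pfin d n (fs : 'I_n -> vec d -> R) (h : vec d -> ereal) (x : vec d) : R :=
  match h x with Some a => favg fs x + a | None => 0 end.

Definition is_minimizer d n (fs : 'I_n -> vec d -> R) (h : vec d -> ereal) (xs : vec d) : Prop :=
  h xs <> None /\ forall y, h y <> None -> Pfin fs h xs <= Pfin fs h y.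

(* Main.v *)
From Stdlib Require Import Reals Lra List FunctionalExtensionality.
From HB Require Import structures.
From mathcomp Require Import ssreflect ssrfun ssrbool eqtype ssrnat seq choice fintype bigop.
Require Import Defs.
Set Implicit Arguments. Unset Strict Implicit.
Open Scope R_scope.

(** Writing [p] for the optimality gap and [w] for the convex combination
    [tau1 z' + tau2 xt + (1 - tau1 - tau2) y], one inner step satisfies, for every point [u]
    known before the step,
      E [p y' + 2 L |y' - w|^2 + 3 L tau1^2 |z' - u|^2]
        <= tau1 p u + tau2 p xt + (1 - tau1 - tau2) p y + 3 L tau1^2 |z - u|^2,
    because the errors of both gradient estimators are paid for by [tau2] times the Bregman
    distance from the snapshot.  With [u] the minimizer and weight [1 / tau1^2] this telescopes
    and settles the case where [tau2] is bounded below or the epochs are short.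

    When [tau2] is small the telescoped bound loses a factor of the order of the number of
    epochs, and a second instance is needed: [u] is taken to be a moving average [U] of past
    iterates that drifts towards [z], so that [|z - U|^2] is damped at every step, while the
    nonnegative weights of the iterates in [U] are arranged so that their gaps are exactly
    refunded.  The resulting energy is nonincreasing, hence controlled by its average over
    the run, which the first instance bounds. *)

(** Clipping makes [v] biased, and averaging over workers does not remove a bias. Hence [v] enters
    only through its squared error, while the terms linear in an estimator, which must vanish on
    average, are carried by the unbiased [vh]. For small [tau2] the first instance gives the
    snapshot only the weight [m * tau2 * horizon ^ 2], with [horizon = 1 / tau1], where
    [m * horizon ^ 2] is wanted. The comparison of the energy with its average is not made by
    summing over the run: both instances are added inside each step, with weight [horizon ^ 2] at
    the minimizer and the rest at [U]. The minimizer has gap zero, so part of the damping stays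
    unspent and the weight of the energy can rise by [horizon / mass] per step, [mass] being the
    total weight of the iterates in [U]. That weight is finally at least of order
    [m * horizon ^ 2 / mass]. If [mass] is large, the snapshot holds a fixed fraction of it; if not,
    a single iterate does. In both cases [mass] cancels. The thresholds 1/576 and 288 keep the
    weight of the energy above [2 * horizon ^ 2], below which the damping would be too weak. *)

HB.instance Definition _ := Monoid.isComLaw.Build R 0 Rplus
  (fun x y z => esym (Rplus_assoc x y z)) Rplus_comm Rplus_0_l.

(** * Sums and vectors *)

Section Sums.
Variable I : Type.
Implicit Types (r : seq I) (F G : I -> R).

Lemma sum_scale r a F :
  \big[Rplus/0]_(i <- r) (a * F i) = a * \big[Rplus/0]_(i <- r) F i.
Proof.
by rewrite (big_morph (Rmult a) (Rmult_plus_distr_l a) (Rmult_0_r a)).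
Qed.

Lemma sum_sub r F G : \big[Rplus/0]_(i <- r) (F i - G i) =
  \big[Rplus/0]_(i <- r) F i - \big[Rplus/0]_(i <- r) G i.
Proof. elim: r => [|i r IH]; rewrite ?big_nil ?big_cons ?IH; ring. Qed.

Lemma sum_const r a : \big[Rplus/0]_(i <- r) a = INR (size r) * a.
Proof.
elim: r => [|i r IH]; first by rewrite big_nil /=; ring.
by rewrite big_cons IH [size (_ :: _)]/= S_INR; ring.
Qed.

Lemma sum_ge0 r F : (forall i, 0 <= F i) -> 0 <= \big[Rplus/0]_(i <- r) F i.
Proof.
move=> F0; elim: r => [|i r IH]; rewrite ?big_nil ?big_cons; first lra.
by have := F0 i; lra.
Qed.

Lemma sum_le r F G : (forall i, F i <= G i) ->
  \big[Rplus/0]_(i <- r) F i <= \big[Rplus/0]_(i <- r) G i.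
Proof.
move=> FG; elim: r => [|i r IH]; rewrite ?big_nil ?big_cons; first lra.
by have := FG i; lra.
Qed.

End Sums.

Section DotProduct.
Variable d : nat.
Implicit Types x y z : vec d.

Lemma dotC x y : dot x y = dot y x.
Proof. by apply: eq_bigr => j _; ring. Qed.

Lemma dotDl x y z : dot (vadd x y) z = dot x z + dot y z.
Proof. by rewrite /dot -big_split; apply: eq_bigr => j _; rewrite /vadd /=; ring. Qed.

Lemma dotBl x y z : dot (vsub x y) z = dot x z - dot y z.
Proof. by rewrite /dot -sum_sub; apply: eq_bigr => j _; rewrite /vsub /=; ring. Qed.

Lemma dotZl a x z : dot (vscale a x) z = a * dot x z.
Proof. by rewrite /dot -sum_scale; apply: eq_bigr => j _; rewrite /vscale /=; ring. Qed.

Lemma dotDr x y z : dot z (vadd x y) = dot z x + dot z y.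
Proof. by rewrite !(dotC z) dotDl. Qed.

Lemma dotBr x y z : dot z (vsub x y) = dot z x - dot z y.
Proof. by rewrite !(dotC z) dotBl. Qed.

Lemma dotZr a x z : dot z (vscale a x) = a * dot z x.
Proof. by rewrite !(dotC z) dotZl. Qed.

End DotProduct.

(* Unlike [rewrite], [autorewrite] does not unfold [vsub] into a sum. *)
#[global] Hint Rewrite @dotDl @dotBl @dotZl @dotDr @dotBr @dotZr : dots.

Ltac vec_ring := apply: functional_extensionality => ?; rewrite /vadd /vsub /vscale; ring.

Section Norm.
Variable d : nat.
Implicit Types x y z : vec d.

Lemma dot_ge0 x : 0 <= dot x x.
Proof. by apply: sum_ge0 => j; have := Rle_0_sqr (x j); rewrite /Rsqr. Qed.

Lemma norm_sq x : norm x ^ 2 = dot x x.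
Proof. by rewrite /norm /= Rmult_1_r sqrt_sqrt //; exact: dot_ge0. Qed.

Lemma norm_ge0 x : 0 <= norm x.
Proof. exact: sqrt_pos. Qed.

Lemma norm_scale a x : norm (vscale a x) = Rabs a * norm x.
Proof.
rewrite /norm dotZl dotZr -Rmult_assoc sqrt_mult.
- by rewrite -[a * a]/(Rsqr a) sqrt_Rsqr_abs.
- by have := Rle_0_sqr a; rewrite /Rsqr.
- exact: dot_ge0.
Qed.

Lemma young a x y : 0 < a -> dot x y <= a * dot x x + dot y y / (4 * a).
Proof.
move=> a0; have := dot_ge0 (vsub (vscale (2 * a) x) y).
autorewrite with dots; rewrite (dotC y x) => H.
apply: (Rmult_le_reg_l (4 * a)); first lra.
have -> : 4 * a * (a * dot x x + dot y y / (4 * a)) = 4 * a * a * dot x x + dot y y.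
  by field; lra.
nra.
Qed.

Lemma cauchy_schwarz x y : dot x y <= norm x * norm y.
Proof.
have nx := norm_ge0 x; have ny := norm_ge0 y.
have key : dot x y * dot x y <= dot x x * dot y y.
  have := dot_ge0 (vsub (vscale (dot y y) x) (vscale (dot x y) y)).
  autorewrite with dots; rewrite (dotC y x) => H.
  have y0 := dot_ge0 y.
  case: y0 => [y0|y0]; first by apply: (Rmult_le_reg_l (dot y y)); [exact: y0 | lra].
  have x0 : forall t, 2 * t * dot x y <= dot x x.
    by move=> t; have := dot_ge0 (vsub x (vscale t y)); autorewrite with dots; rewrite (dotC y x) -y0; lra.
  case: (Req_dec (dot x y) 0) => [->|q0]; first by rewrite -y0; lra.
  (* With [y] of norm zero the bound is linear in [t]; this [t] would make it read
     [1 + dot x x <= dot x x]. *)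
  have := x0 ((1 + dot x x) / (2 * dot x y)).
  by have -> : 2 * ((1 + dot x x) / (2 * dot x y)) * dot x y = 1 + dot x x; [field | lra].
rewrite -!norm_sq in key.
have : Rabs (dot x y) <= Rabs (norm x * norm y).
  by apply: Rsqr_le_abs_0; rewrite /Rsqr; lra.
rewrite (Rabs_pos_eq (norm x * norm y)); last by nra.
by have := Rle_abs (dot x y); lra.
Qed.

End Norm.

(** * Finite distributions *)

(** A distribution may list outcomes of weight zero, as the quantizer does at a grid point; these
    must not count as possible. *)
Definition supp A (m : dist A) (a : A) : Prop := exists p, List.In (p, a) m /\ 0 < p.

Definition is_prob A (m : dist A) : Prop :=
  (forall pa, List.In pa m -> 0 <= pa.1) /\ expect m (fun _ => 1) = 1.

Section Expectation.
Variables (A B : Type).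
Implicit Types (m : dist A) (F G : A -> R) (k : A -> dist B).

Lemma expect_ret (a : A) F : expect (dret a) F = F a.
Proof. by rewrite /expect /dret big_seq1 /= Rmult_1_l. Qed.

Lemma expect_bind m k (F : B -> R) :
  expect (dbind m k) F = expect m (fun a => expect (k a) F).
Proof.
rewrite /expect /dbind big_flatten big_map; apply: eq_bigr => pa _.
by rewrite big_map -sum_scale; apply: eq_bigr => qb _ /=; ring.
Qed.

Lemma expect_ext m F G : (forall a, F a = G a) -> expect m F = expect m G.
Proof. by move=> FG; apply: eq_bigr => pa _; rewrite FG. Qed.

Lemma expectD m F G : expect m (fun a => F a + G a) = expect m F + expect m G.
Proof. by rewrite /expect -big_split; apply: eq_bigr => pa _ /=; ring. Qed.

Lemma expectZ m c F : expect m (fun a => c * F a) = c * expect m F.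
Proof. by rewrite /expect -sum_scale; apply: eq_bigr => pa _; ring. Qed.

Lemma expectB m F G : expect m (fun a => F a - G a) = expect m F - expect m G.
Proof. by rewrite /expect -sum_sub; apply: eq_bigr => pa _ /=; ring. Qed.

Lemma expect_sum (I : Type) m (r : seq I) (F : I -> A -> R) :
  expect m (fun a => \big[Rplus/0]_(i <- r) F i a) =
  \big[Rplus/0]_(i <- r) expect m (F i).
Proof.
rewrite /expect exchange_big; apply: eq_bigr => pa _ /=.
by rewrite -sum_scale.
Qed.

Lemma expect_const m c : is_prob m -> expect m (fun _ => c) = c.
Proof.
case=> _ m1; rewrite -[RHS]Rmult_1_r -[in RHS]m1 -expectZ.
by apply: expect_ext => a; ring.
Qed.

Lemma expect_le_supp m F G : is_prob m -> (forall a, supp m a -> F a <= G a) ->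
  expect m F <= expect m G.
Proof.
case=> m0 _; rewrite /expect; elim: m m0 => [|[p a] m IH] m0 FG.
  by rewrite !big_nil; lra.
rewrite !big_cons /=; apply: Rplus_le_compat.
  case: (m0 (p, a)) => [|/= p0|/= <-]; [by left| |lra].
  by apply: Rmult_le_compat_l; [lra | apply: FG; exists p; split=> //; left].
apply: IH => [pa pam|b [q [qm q0]]]; first by apply: m0; right.
by apply: FG; exists q; split=> //; right.
Qed.

Lemma expect_le m F G : is_prob m -> (forall a, F a <= G a) ->
  expect m F <= expect m G.
Proof. by move=> mP FG; apply: expect_le_supp. Qed.

Lemma expect_sq_le m F : is_prob m ->
  expect m F * expect m F <= expect m (fun a => F a * F a).
Proof.
move=> mP; set e := expect m F.
have : expect m (fun a => 2 * e * F a - e * e) <= expect m (fun a => F a * F a).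
  by apply: expect_le => // a; have := Rle_0_sqr (F a - e); rewrite /Rsqr; lra.
by rewrite expectB expectZ expect_const // -/e; lra.
Qed.

Lemma is_prob_ret (a : A) : is_prob (dret a).
Proof. by split; [move=> pa [<-|[]] /=; lra | rewrite expect_ret]. Qed.

Lemma in_bind m k (pb : R * B) : List.In pb (dbind m k) ->
  exists p a q, [/\ List.In (p, a) m, List.In (q, pb.2) (k a) & pb.1 = p * q].
Proof.
elim: m => [|[p a] m IH] //=; rewrite /dbind /= => /(in_app_or _ _ _) [|/IH].
  move/in_map_iff => [[q b] [<- qb]] /=; exists p, a, q; split=> //; by left.
move=> [p' [a' [q [h1 h2 h3]]]]; exists p', a', q; split=> //; by right.
Qed.

Lemma bind_in m k p a q (b : B) : List.In (p, a) m -> List.In (q, b) (k a) ->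
  List.In (p * q, b) (dbind m k).
Proof.
elim: m => [|[p' a'] m IH] //= [[-> ->]|h1] h2; rewrite /dbind /=; apply: in_or_app.
  by left; apply/in_map_iff; exists (q, b).
by right; apply: IH.
Qed.

Lemma is_prob_bind m k : is_prob m -> (forall a, is_prob (k a)) -> is_prob (dbind m k).
Proof.
move=> mP kP; split.
  move=> pb /in_bind [p [a [q [h1 h2 ->]]]].
  by apply: Rmult_le_pos; [apply: (proj1 mP _ h1) | apply: (proj1 (kP a) _ h2)].
rewrite expect_bind (expect_ext m (G := fun _ => 1)); first exact: (proj2 mP).
by move=> a; case: (kP a).
Qed.

Lemma supp_bind_intro m k a b : supp m a -> supp (k a) b -> supp (dbind m k) b.
Proof.
move=> [p [h1 p0]] [q [h2 q0]]; exists (p * q); split; first exact: bind_in h1 h2.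
exact: Rmult_lt_0_compat.
Qed.

Lemma supp_bind m k b : is_prob m -> (forall a, is_prob (k a)) -> supp (dbind m k) b ->
  exists2 a, supp m a & supp (k a) b.
Proof.
move=> mP kP [pq [/in_bind [p [a [q [/= h1 h2 pqE]]]] pq0]].
have p0 := proj1 mP _ h1; have q0 := proj1 (kP a) _ h2; rewrite /= in p0 q0.
have pp : 0 < p by case: p0 => // p0; move: pq0; rewrite pqE -p0; lra.
have qp : 0 < q by case: q0 => // q0; move: pq0; rewrite pqE -q0; lra.
by exists a; [exists p | exists q].
Qed.

Lemma supp_ret (a b : A) : supp (dret a) b -> b = a.
Proof. by case=> p [[[_ ->]|[]]]. Qed.

Lemma supp_ret_self (a : A) : supp (dret a) a.
Proof. by exists 1; split; [left | lra]. Qed.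

Lemma supp_nonempty m : is_prob m -> exists a, supp m a.
Proof.
case=> m0; rewrite /expect; elim: m m0 => [|[p a] m IH] m0.
  by rewrite big_nil; lra.
case: (m0 (p, a)) => [|/= p0 _|/= p0]; first by left.
  by exists a, p; split=> //; left.
rewrite big_cons /= -p0 Rmult_0_l Rplus_0_l => m1.
case: IH => [pa pam||b [q [qm q0]]] //; first by apply: m0; right.
by exists b, q; split=> //; right.
Qed.

Lemma almost_surelyP m (Q : A -> Prop) :
  almost_surely m Q <-> forall a, supp m a -> Q a.
Proof.
split=> [H a [p [h1 p0]]|H [p a] h1 p0]; first exact: (H (p, a)).
by apply: H; exists p.
Qed.

End Expectation.

Lemma is_prob_uniform n : (0 < n)%N -> is_prob (duniform n).
Proof.
move=> n0; have nR : 0 < INR n by apply: lt_0_INR; apply/ltP.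
split.
  move=> pa /in_map_iff [i [<- _]] /=; apply: Rlt_le; exact: Rinv_0_lt_compat.
rewrite /expect /duniform big_map /= sum_const size_enum_ord; field; lra.
Qed.

Section Sequences.
Variable A : Type.
Implicit Types (m : dist A) (F G : A -> R).

Lemma is_prob_seq (l : seq (dist A)) : (forall m, List.In m l -> is_prob m) ->
  is_prob (dseq l).
Proof.
elim: l => [|m l IH] H /=; first exact: is_prob_ret.
apply: is_prob_bind => [|a]; first by apply: H; left.
apply: is_prob_bind => [|r]; last exact: is_prob_ret.
by apply: IH => m' h; apply: H; right.
Qed.

Lemma is_prob_iid k m : is_prob m -> is_prob (diid k m).
Proof.
move=> mP; apply: is_prob_seq => m'; elim: k => [|k IH] //= [<-|] //.
Qed.

Lemma expect_iidS k m (H : seq A -> R) :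
  expect (diid k.+1 m) H = expect m (fun a => expect (diid k m) (fun l => H (a :: l))).
Proof.
rewrite /diid /= expect_bind; apply: expect_ext => a.
by rewrite expect_bind; apply: expect_ext => l; rewrite expect_ret.
Qed.

Lemma expect_iid_sum k m F : is_prob m ->
  expect (diid k m) (fun l => \big[Rplus/0]_(a <- l) F a) = INR k * expect m F.
Proof.
move=> mP; elim: k => [|k IH].
  by rewrite /diid /= expect_ret big_nil; ring.
rewrite expect_iidS S_INR (expect_ext m (G := fun a => F a + INR k * expect m F)).
  by rewrite expectD expect_const //; ring.
move=> a; rewrite (expect_ext _ (G := fun l => F a + \big[Rplus/0]_(b <- l) F b)).
  by rewrite expectD IH expect_const //; exact: is_prob_iid.
by move=> l; rewrite big_cons.
Qed.

(** Independence factors the [k (k - 1)] ordered pairs of distinct draws; the diagonal keeps the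
    second moment. *)
Lemma expect_iid_sum_sq k m F : is_prob m ->
  expect (diid k m) (fun l => (\big[Rplus/0]_(a <- l) F a) * \big[Rplus/0]_(a <- l) F a) =
  INR k * expect m (fun a => F a * F a) + INR k * (INR k - 1) * (expect m F * expect m F).
Proof.
move=> mP; elim: k => [|k IH].
  by rewrite /diid /= expect_ret big_nil; ring.
rewrite expect_iidS S_INR; set s2 := expect m (fun a => F a * F a); set s1 := expect m F.
have [c cE] : exists c, c = INR k * s2 + INR k * (INR k - 1) * (s1 * s1) by eexists.
rewrite (expect_ext m (G := fun a => F a * F a + 2 * INR k * s1 * F a + c)).
  by rewrite !expectD expectZ expect_const // -/s1 -/s2 cE; ring.
move=> a; rewrite (expect_ext _ (G := fun l => F a * F a +
   2 * F a * (\big[Rplus/0]_(b <- l) F b) +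
   (\big[Rplus/0]_(b <- l) F b) * \big[Rplus/0]_(b <- l) F b)).
  rewrite 2!expectD (expectZ _ (2 * F a)) IH (expect_iid_sum k F mP) expect_const; last exact: is_prob_iid.
  by rewrite -/s1 -/s2 cE; ring.
by move=> l; rewrite !big_cons; ring.
Qed.

(** The draws have different laws, but a sum of functions of single draws sees only the marginals;
    this reduces the vector quantizer to its coordinates. *)
Lemma expect_seq_nth (a0 : A) (l : seq (dist A)) (H : nat -> A -> R) :
  (forall m, List.In m l -> is_prob m) ->
  expect (dseq l) (fun r => \big[Rplus/0]_(i < size l) H i (nth a0 r i)) =
  \big[Rplus/0]_(i < size l) expect (nth [::] l i) (H i).
Proof.
elim: l H => [|m l IH] H lP /=.
  by rewrite !big_ord0 expect_ret big_ord0.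
have mP : is_prob m by apply: lP; left.
have lP' m' : List.In m' l -> is_prob m' by move=> h; apply: lP; right.
rewrite expect_bind big_ord_recl /=.
rewrite (expect_ext m (G := fun a => H 0%N a +
   \big[Rplus/0]_(i < size l) expect (nth [::] l i) (H i.+1))).
  by rewrite expectD expect_const.
move=> a; rewrite expect_bind -(IH (fun i => H i.+1)) //.
rewrite (expect_ext _ (G := fun r => H 0%N a +
   \big[Rplus/0]_(i < size l) H i.+1 (nth a0 r i))).
  by rewrite expectD expect_const //; exact: is_prob_seq.
by move=> r; rewrite expect_ret big_ord_recl.
Qed.

Lemma supp_iid_in k m a : is_prob m -> supp m a ->
  exists l, supp (diid k.+1 m) (a :: l).
Proof.
move=> mP ma; have [l hl] := supp_nonempty (is_prob_iid k mP).
exists l; rewrite /diid /=; apply: (supp_bind_intro ma).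
by apply: (supp_bind_intro hl); exact: supp_ret_self.
Qed.

End Sequences.

Lemma is_prob_repeat A k (f : A -> dist A) a :
  (forall a, is_prob (f a)) -> is_prob (drepeat k f a).
Proof.
move=> fP; elim: k a => [|k IH] a /=; first exact: is_prob_ret.
exact: is_prob_bind.
Qed.

(** * Smooth convex functions and proximal steps *)

Section SmoothConvex.
Variables (d : nat) (f : vec d -> R) (g : vec d -> vec d).
Hypothesis fg : is_gradient f g.

Lemma derivable_along_line x v t :
  derivable_pt_lim (fun s => f (vadd x (vscale s v))) t (dot (g (vadd x (vscale t v))) v).
Proof.
move=> eps eps0; have nv := norm_ge0 v.
have e0 : 0 < eps / (2 * (norm v + 1)) by apply: Rdiv_lt_0_compat; lra.
have [del [del0 H]] := fg (vadd x (vscale t v)) e0.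
have d0 : 0 < del / (norm v + 1) by apply: Rdiv_lt_0_compat; lra.
exists (mkposreal _ d0) => s s0 /= sdel.
have sp : 0 < Rabs s by apply: Rabs_pos_lt.
have sn : norm (vscale s v) = Rabs s * norm v by exact: norm_scale.
have lt1 : norm (vscale s v) < del.
  rewrite sn; apply: (Rle_lt_trans _ (Rabs s * (norm v + 1))); first nra.
  by have := Rmult_lt_compat_r (norm v + 1) _ _ ltac:(lra) sdel;
     rewrite /Rdiv Rmult_assoc Rinv_l; lra.
move: (H _ lt1).
have -> : vadd (vadd x (vscale t v)) (vscale s v) = vadd x (vscale (t + s) v) by vec_ring.
rewrite dotZr sn => {}H.
set D := f _ - f _ in H *.
have -> : D / s - dot (g (vadd x (vscale t v))) v =
  (D - s * dot (g (vadd x (vscale t v))) v) * / s by field.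
rewrite Rabs_mult Rabs_inv; apply: (Rmult_lt_reg_r (Rabs s)) => //.
rewrite Rmult_assoc Rinv_l; last lra.
rewrite Rmult_1_r; apply: (Rle_lt_trans _ _ _ H).
have -> : eps / (2 * (norm v + 1)) * (Rabs s * norm v) =
  (eps * Rabs s) * (norm v / (2 * (norm v + 1))) by field; lra.
have : norm v / (2 * (norm v + 1)) < 1.
  apply: (Rmult_lt_reg_r (2 * (norm v + 1))); first lra.
  by rewrite /Rdiv Rmult_assoc Rinv_l; lra.
have : 0 < eps * Rabs s by apply: Rmult_lt_0_compat.
nra.
Qed.

Lemma descent L x y : 0 <= L ->
  (forall x y, norm (vsub (g x) (g y)) <= L * norm (vsub x y)) ->
  f y <= f x + dot (g x) (vsub y x) + L / 2 * dot (vsub y x) (vsub y x).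
Proof.
move=> L0 gL; set v := vsub y x.
pose psi s := f (vadd x (vscale s v)) - dot (g x) v * s - L / 2 * dot v v * s ^ 2.
pose psi' s := dot (g (vadd x (vscale s v))) v - dot (g x) v * 1 - L * dot v v * s.
have [||c [E c01]] := MVT_cor2 psi psi' 0 1; first lra.
  move=> c _; rewrite /psi /psi'.
  apply: derivable_pt_lim_minus; last first.
    have -> : L * dot v v * c = L / 2 * dot v v * (INR 2 * c ^ 1) by rewrite /=; field.
    by apply: (derivable_pt_lim_scal (fun s => s ^ 2)); exact: derivable_pt_lim_pow.
  apply: derivable_pt_lim_minus; first exact: derivable_along_line.
  by apply: (derivable_pt_lim_scal (fun s => s)); exact: derivable_pt_lim_id.
have x1 : vadd x (vscale 1 v) = y by rewrite /v; vec_ring.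
have x0 : vadd x (vscale 0 v) = x by rewrite /v; vec_ring.
move: E; rewrite /psi /psi' x1 x0.
have cs := cauchy_schwarz (vsub (g (vadd x (vscale c v))) (g x)) v.
have := gL (vadd x (vscale c v)) x.
have -> : vsub (vadd x (vscale c v)) x = vscale c v by vec_ring.
rewrite norm_scale Rabs_pos_eq; last lra.
move=> gl; have nv := norm_ge0 v.
have : dot (vsub (g (vadd x (vscale c v))) (g x)) v <= L * c * dot v v.
  by rewrite -norm_sq; nra.
rewrite dotBl; lra.
Qed.

(** Convexity at [x + t v] is compared with the first-order expansion at [x]; dividing by a small
    [t] leaves an arbitrary error [eps]. *)
Lemma convex_gradient x y : convex_fun f -> f x + dot (g x) (vsub y x) <= f y.
Proof.
move=> fc; set v := vsub y x; have nv := norm_ge0 v.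
apply: le_epsilon => eps eps0.
have e0 : 0 < eps / (norm v + 1) by apply: Rdiv_lt_0_compat; lra.
have [del [del0 H]] := fg x e0.
pose t := Rmin 1 (del / (2 * (norm v + 1))).
have d0 : 0 < del / (2 * (norm v + 1)) by apply: Rdiv_lt_0_compat; lra.
have t0 : 0 < t by apply: Rmin_glb_lt; lra.
have t1 : t <= 1 := Rmin_l _ _.
have td : t * (norm v + 1) <= del / 2.
  have : t <= del / (2 * (norm v + 1)) := Rmin_r _ _.
  move/(Rmult_le_compat_r (norm v + 1) _ _ ltac:(lra)).
  by have -> : del / (2 * (norm v + 1)) * (norm v + 1) = del / 2 by field; lra.
have nt : norm (vscale t v) = t * norm v by rewrite norm_scale Rabs_pos_eq; lra.
have lt1 : norm (vscale t v) < del by rewrite nt; nra.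
move: (H _ lt1); rewrite dotZr nt.
have := fc y x t ltac:(lra).
have -> : vadd (vscale t y) (vscale (1 - t) x) = vadd x (vscale t v) by rewrite /v; vec_ring.
move=> c1 h; have := Rle_abs (- (f (vadd x (vscale t v)) - f x - t * dot (g x) v)).
rewrite Rabs_Ropp => h1.
have : eps / (norm v + 1) * (t * norm v) <= t * eps.
  have -> : eps / (norm v + 1) * (t * norm v) = t * eps * (norm v / (norm v + 1)) by field; lra.
  have : norm v / (norm v + 1) <= 1.
    apply: (Rmult_le_reg_r (norm v + 1)); first lra.
    by rewrite /Rdiv Rmult_assoc Rinv_l; lra.
  by have := Rmult_lt_0_compat _ _ t0 eps0; nra.
move=> h2; apply: (Rmult_le_reg_l t) => //; nra.
Qed.

(** At the point [w], a gradient step of length [1 / L] from [y] for [f] minus its tangent at [x],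
    the tangent at [x] bounds [f] from below and the descent inequality at [y] bounds it from
    above. *)
Lemma cocoercive L x y : 0 < L ->
  (forall x y, norm (vsub (g x) (g y)) <= L * norm (vsub x y)) -> convex_fun f ->
  dot (vsub (g x) (g y)) (vsub (g x) (g y)) <=
    2 * L * (f y - f x - dot (g x) (vsub y x)).
Proof.
move=> L0 gL fc; set G := vsub (g x) (g y).
pose w := vadd y (vscale (/ L) G).
have c1 := convex_gradient x w fc.
have c2 := descent y w (Rlt_le _ _ L0) gL.
have wy : vsub w y = vscale (/ L) G by rewrite /w; vec_ring.
have wx : vsub w x = vadd (vsub y x) (vscale (/ L) G) by rewrite /w; vec_ring.
rewrite wy dotZl !dotZr in c2; rewrite wx dotDr dotZr in c1.
have GG : dot G G = dot (g x) G - dot (g y) G by rewrite {1}/G dotBl.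
have E : L / 2 * (/ L * (/ L * dot G G)) = / (2 * L) * dot G G by field; lra.
rewrite E in c2.
have : / (2 * L) * dot G G <= f y - f x - dot (g x) (vsub y x).
  have -> : / (2 * L) * dot G G = / L * dot G G - / (2 * L) * dot G G by field; lra.
  by rewrite {1}GG; lra.
move/(Rmult_le_compat_l (2 * L) _ _ ltac:(lra)).
by rewrite -Rmult_assoc Rinv_r; lra.
Qed.

End SmoothConvex.

Section Prox.
Variables (d : nat) (h : vec d -> ereal).
Hypothesis hc : convex_ext h.

(* The minimized function is [2c]-strongly convex, whence the extra term. *)
Lemma prox_strong prox c x v w hw : is_prox h prox -> 0 < c -> h w = Some hw ->
  exists2 hp, h (prox c x v) = Some hp &
  c * dot (vsub (prox c x v) x) (vsub (prox c x v) x) + dot v (prox c x v) + hp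
    + c * dot (vsub w (prox c x v)) (vsub w (prox c x v))
  <= c * dot (vsub w x) (vsub w x) + dot v w + hw.
Proof.
move=> proxP c0 hwE; have [hp [hpE H]] := proxP c x v c0.
exists hp => //; set q := prox c x v in hpE H *.
have [k kE] : exists k, k = vsub w q by eexists.
have wx : vsub w x = vadd (vsub q x) k by rewrite kE; vec_ring.
have wq : dot v w = dot v q + dot v k by rewrite kE dotBr; ring.
rewrite -kE wx wq !(dotDl (vsub q x)) !(dotDr (vsub q x)) (dotC k (vsub q x)).
set a := dot (vsub q x) k; set kk := dot k k.
suff : 0 <= 2 * c * a + dot v k + hw - hp by lra.
apply: Rnot_lt_le => neg; set s := _ - hp in neg.
have kk0 : 0 <= kk by exact: dot_ge0.
(* Moving from the minimizer [q] by the fraction [t] towards [w] changes the objective by at most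
   [t * (s + t * (c * kk))], which this [t] makes negative. *)
pose t := Rmin 1 (- s / (2 * (c * kk + 1))).
have ck : 0 <= c * kk by apply: Rmult_le_pos; lra.
have d0 : 0 < - s / (2 * (c * kk + 1)) by apply: Rdiv_lt_0_compat; lra.
have t0 : 0 < t by apply: Rmin_glb_lt; lra.
have t1 : t <= 1 := Rmin_l _ _.
have ts : t * (c * kk + 1) <= - s / 2.
  have : t <= - s / (2 * (c * kk + 1)) := Rmin_r _ _.
  move/(Rmult_le_compat_r (c * kk + 1) _ _ ltac:(lra)).
  by have -> : - s / (2 * (c * kk + 1)) * (c * kk + 1) = - s / 2 by field; lra.
have [e [eE eH]] := hc (conj (Rlt_le _ _ t0) t1) hwE hpE.
have := H _ _ eE; rewrite !norm_sq.
have -> : vsub (vadd (vscale t w) (vscale (1 - t) q)) x = vadd (vsub q x) (vscale t k).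
  by rewrite kE; vec_ring.
have -> : vadd (vscale t w) (vscale (1 - t) q) = vadd q (vscale t k) by rewrite kE; vec_ring.
rewrite (dotDl (vsub q x)) !(dotDr (vsub q x)) (dotDr q) !(dotZl t k) !(dotZr t k) (dotC k (vsub q x)) -/a -/kk => {}H.
have : 0 <= t * (s + t * (c * kk)) by rewrite /s; lra.
have : s + t * (c * kk) < 0 by lra.
nra.
Qed.

End Prox.

(** * Quantization *)

Section NormInf.
Variable d : nat.
Implicit Types u : vec d.

Lemma norm_inf_ge0 u : 0 <= norm_inf u.
Proof.
rewrite /norm_inf; elim/big_ind: _ => [|x y _ y0|j _]; [lra | | exact: Rabs_pos].
exact: Rle_trans y0 (Rmax_r _ _).
Qed.

Lemma le_norm_inf u j : Rabs (u j) <= norm_inf u.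
Proof.
rewrite /norm_inf.
have: j \in index_enum 'I_d by rewrite mem_index_enum.
elim: (index_enum _) => [|i r IH] //; rewrite inE big_cons => /orP [/eqP <-|/IH h].
  exact: Rmax_l.
exact: Rle_trans h (Rmax_r _ _).
Qed.

Lemma norm_inf_sq u : norm_inf u ^ 2 <= dot u u.
Proof.
suff [] : 0 <= norm_inf u /\ norm_inf u ^ 2 <= dot u u by [].
rewrite /norm_inf /dot.
elim/big_ind2: _ => [|x1 x2 y1 y2 [h1 h2] [h3 h4]|j _]; first by split; lra.
  by split; [exact: Rle_trans h1 (Rmax_l _ _) | rewrite /Rmax; case: Rle_dec => ? /=; nra].
by split; [exact: Rabs_pos | rewrite -Rsqr_pow2 -Rsqr_abs /Rsqr; lra].
Qed.

End NormInf.

Section Quantizer.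
Variables (delta : R) (b : nat).
Hypothesis delta_ge0 : 0 <= delta.

Definition out_of_range (y : R) : bool :=
  if Rlt_dec y (grid_lo delta b) then true
  else if Rlt_dec (grid_hi delta b) y then true else false.

Lemma floor_grid y : 0 < delta ->
  0 <= y - delta * IZR (Int_part (y / delta)) <= delta.
Proof.
move=> d0; have [h1 h2] := base_Int_part (y / delta).
have E : y = delta * (y / delta) by field; lra.
move: h1 h2 E; move: (IZR (Int_part (y / delta))) => k; move: (y / delta) => q h1 h2 ->; nra.
Qed.

Lemma is_prob_quant_scalar y : is_prob (quant_scalar delta b y).
Proof.
rewrite /quant_scalar; case: (Req_EM_T delta 0) => [?|d0] /=; first exact: is_prob_ret.
case: Rlt_dec => ? /=; first exact: is_prob_ret.
case: Rlt_dec => ? /=; first exact: is_prob_ret.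
have dp : 0 < delta by lra.
have := floor_grid y dp; set z := delta * _ => zy.
split; last by rewrite /expect big_cons big_seq1 /=; field.
by move=> pa [<-|[<-|[]]] /=; apply: Rmult_le_pos; try lra;
  apply: Rlt_le; exact: Rinv_0_lt_compat.
Qed.

(** Inside the grid the randomized rounding has variance [(y - z) * (delta - (y - z))], at most
    [delta ^ 2 / 4]; outside, clipping is deterministic and its error is the overshoot. *)
Lemma quant_scalar_mse y c : 0 <= c ->
  (delta = 0 -> y = 0) ->
  (out_of_range y -> y < grid_lo delta b -> grid_lo delta b - y <= c) ->
  (out_of_range y -> grid_hi delta b < y -> y - grid_hi delta b <= c) ->
  expect (quant_scalar delta b y) (fun q => (q - y) ^ 2)
    <= delta ^ 2 / 4 + (if out_of_range y then c ^ 2 else 0).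
Proof.
move=> c0 y0; rewrite /out_of_range /quant_scalar.
case: (Req_EM_T delta 0) => [dE|d0] /=.
  rewrite expect_ret (y0 dE) dE => _ _.
  set e := (if _ then _ else _).
  have : 0 <= e by rewrite /e; case: ifP => _; nra.
  lra.
have dd : 0 <= delta ^ 2 / 4 by nra.
case: Rlt_dec => [lo|lo] /=.
  by rewrite expect_ret => /(_ erefl lo) h _; nra.
case: Rlt_dec => [hi|hi] /=.
  by rewrite expect_ret => _ /(_ erefl hi) h; nra.
move=> _ _; have dp : 0 < delta by lra.
have := floor_grid y dp; set z := delta * _ => zy.
rewrite /expect big_cons big_seq1 /=.
have -> : (z + delta - y) / delta * ((z - y) * ((z - y) * 1)) +
   (y - z) / delta * ((z + delta - y) * ((z + delta - y) * 1)) =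
   (y - z) * (delta - (y - z)) by field.
have := Rle_0_sqr (delta / 2 - (y - z)); rewrite /Rsqr; lra.
Qed.

Lemma is_prob_quant_vec d (u : vec d) : is_prob (quant_vec delta b u).
Proof.
apply: is_prob_bind => [|l]; last exact: is_prob_ret.
by apply: is_prob_seq => m /in_map_iff [j [<- _]]; exact: is_prob_quant_scalar.
Qed.

Lemma expect_quant_vec d (u : vec d) :
  expect (quant_vec delta b u) (fun q => dot (vsub q u) (vsub q u)) =
  \big[Rplus/0]_(j < d) expect (quant_scalar delta b (u j)) (fun q => (q - u j) ^ 2).
Proof.
pose ms := map (fun j => quant_scalar delta b (u j)) (enum 'I_d).
pose us := map u (enum 'I_d).
have usE (j : 'I_d) : nth 0 us j = u j.
  by rewrite (nth_map j) ?size_enum_ord // nth_ord_enum.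
have msE (j : 'I_d) : nth [::] ms j = quant_scalar delta b (u j).
  by rewrite (nth_map j) ?size_enum_ord // nth_ord_enum.
have sz : size ms = d by rewrite size_map size_enum_ord.
have := @expect_seq_nth R 0 ms (fun i q => (q - nth 0 us i) ^ 2); rewrite sz => E.
rewrite /quant_vec expect_bind -/ms.
transitivity (\big[Rplus/0]_(j < d) expect (nth [::] ms j) (fun q => (q - nth 0 us j) ^ 2)).
  rewrite -E; last by move=> m /in_map_iff [j [<- _]]; exact: is_prob_quant_scalar.
  apply: expect_ext => l; rewrite expect_ret; apply: eq_bigr => j _.
  by rewrite usE /vsub; ring.
by apply: eq_bigr => j _; rewrite usE msE.
Qed.

Lemma sum_indicator (I : Type) (r : seq I) (a : pred I) c :
  \big[Rplus/0]_(i <- r) (if a i then c else 0) = INR (count a r) * c.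
Proof.
elim: r => [|i r IH]; rewrite ?big_nil ?big_cons /=; first ring.
by rewrite IH plus_INR; case: (a i) => /=; ring.
Qed.

End Quantizer.

Lemma grid_size_ge1 b : (2 <= b)%N -> 1 <= 2 ^ b.-1 - 1.
Proof.
case: b => [|[|b]] // _; rewrite [_.+2.-1]/=.
have := pow_R1_Rle 2 b ltac:(lra); rewrite /=; lra.
Qed.

(** The step size puts the upper end of the grid exactly at [lam * M], with [M] the sup norm, and
    the lower end one cell beyond [- lam * M]; a clipped coordinate thus overshoots by at most
    [(1 - lam) * M]. Finally [M ^ 2 <= dot u u]. *)
Lemma quant_vec_mse d (u : vec d) lam dlam b : (2 <= b)%N -> 0 < lam <= 1 ->
  let delta := lam * norm_inf u / (2 ^ b.-1 - 1) in
  INR (n_out delta b u) <= dlam ->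
  expect (quant_vec delta b u) (fun q => dot (vsub q u) (vsub q u)) <=
  (INR d * lam ^ 2 / (4 * (2 ^ b.-1 - 1) ^ 2) + dlam * (1 - lam) ^ 2) * dot u u.
Proof.
move=> b2 lam01 delta; have K1 := grid_size_ge1 b2.
set K := 2 ^ b.-1 - 1 in delta K1 *.
set M := norm_inf u in delta *; have M0 : 0 <= M := norm_inf_ge0 u.
have Kd : K * delta = lam * M by rewrite /delta; field; lra.
have d0 : 0 <= delta by apply: Rmult_le_pos; [nra | apply: Rlt_le; apply: Rinv_0_lt_compat; lra].
have dE : delta ^ 2 = lam ^ 2 / K ^ 2 * M ^ 2 by rewrite /delta; field; lra.
clearbody delta.
have hiE : grid_hi delta b = lam * M by rewrite -Kd.
have loE : grid_lo delta b = - (lam * M) - delta.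
  by rewrite -Kd /grid_lo /K; ring.
move=> nout; rewrite expect_quant_vec //.
have le1 (j : 'I_d) : expect (quant_scalar delta b (u j)) (fun q => (q - u j) ^ 2)
    <= delta ^ 2 / 4 + (if out_of_range delta b (u j) then ((1 - lam) * M) ^ 2 else 0).
  have uM := le_norm_inf u j; rewrite -/M in uM.
  have h1 := Rle_abs (u j); have h2 := Rle_abs (- u j); rewrite Rabs_Ropp in h2.
  apply: quant_scalar_mse => //; rewrite ?hiE ?loE; try nra.
apply: (Rle_trans _ _ _ (sum_le _ le1)); rewrite big_split.
rewrite sum_const (@sum_indicator _ _ (fun j => out_of_range delta b (u j))).
have -> : size (index_enum 'I_d) = d by rewrite -[RHS]size_enum_ord enumT.
have -> : count (fun j => out_of_range delta b (u j)) (index_enum 'I_d) = n_out delta b u.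
  by rewrite /n_out enumT.
have Msq := norm_inf_sq u; rewrite -/M in Msq.
rewrite dE.
have -> : INR d * (lam ^ 2 / K ^ 2 * M ^ 2 / 4) = INR d * lam ^ 2 / (4 * K ^ 2) * M ^ 2.
  by field; lra.
have -> : INR (n_out delta b u) * ((1 - lam) * M) ^ 2 =
   INR (n_out delta b u) * ((1 - lam) ^ 2 * M ^ 2) by ring.
have c1 : 0 <= INR d * lam ^ 2 / (4 * K ^ 2).
  apply: Rmult_le_pos; first by apply: Rmult_le_pos; [exact: pos_INR | nra].
  by apply: Rlt_le; apply: Rinv_0_lt_compat; nra.
have c2 : 0 <= (1 - lam) ^ 2 by nra.
have c3 := pos_INR (n_out delta b u).
rewrite Rmult_plus_distr_r; apply: Rplus_le_compat; first exact: Rmult_le_compat_l.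
rewrite Rmult_assoc; apply: Rmult_le_compat => //; first by apply: Rmult_le_pos => //; nra.
exact: Rmult_le_compat_l.
Qed.

Lemma INR_gt0 k : (0 < k)%N -> 0 < INR k.
Proof. by move=> k0; apply: lt_0_INR; apply/ltP. Qed.

(** * Gradient estimators *)

Section Averages.
Variables (A : Type) (d : nat) (m : dist A) (phi : A -> vec d).
Hypothesis mP : is_prob m.

Definition vexpect : vec d := fun j => expect m (fun a => phi a j).

Lemma expect_dot (v : vec d) : expect m (fun a => dot v (phi a)) = dot v vexpect.
Proof.
rewrite /dot expect_sum; apply: eq_bigr => j _.
by rewrite expectZ.
Qed.

Lemma vexpect_sq_le : dot vexpect vexpect <= expect m (fun a => dot (phi a) (phi a)).
Proof. by rewrite /dot expect_sum; apply: sum_le => j; exact: expect_sq_le. Qed.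

(** The bias-variance decomposition: averaging [k] draws shrinks the variance but not the bias. It
    serves for the batch, where the bias is zero, and for the workers, where it is not. *)
Lemma iid_mean_sq k (c : vec d) : (0 < k)%N ->
  expect (diid k m) (fun l => dot (vsub (vscale (/ INR k) (vsum l phi)) c)
                                  (vsub (vscale (/ INR k) (vsum l phi)) c)) =
  / INR k * expect m (fun a => dot (vsub (phi a) c) (vsub (phi a) c)) +
  (1 - / INR k) * dot (vsub vexpect c) (vsub vexpect c).
Proof.
move=> k0; have kR := INR_gt0 k0.
rewrite /dot !expect_sum -!sum_scale -big_split; apply: eq_bigr => j _.
rewrite /vsub /vscale /vsum /vexpect /=; set F := fun a => phi a j.
pose S (l : seq A) := \big[Rplus/0]_(a <- l) F a.
rewrite (expect_ext _ (G := fun l => / INR k * / INR k * (S l * S l) -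
  2 * c j * / INR k * S l + c j * c j)); last by move=> l; rewrite -/(S l); ring.
rewrite (expect_ext m (G := fun a => F a * F a - 2 * c j * F a + c j * c j));
  last by move=> a; rewrite /F; ring.
rewrite (expectD (diid k m)) (expectD m) (expectB (diid k m)) (expectB m).
rewrite (expectZ _ (/ INR k * / INR k)) (expectZ _ (2 * c j * / INR k)).
rewrite (expectZ m (2 * c j)).
rewrite (expect_iid_sum_sq k F mP) (expect_iid_sum k F mP).
rewrite (expect_const (c j * c j) mP) (expect_const (c j * c j) (is_prob_iid k mP)).
field; lra.
Qed.

Lemma iid_mean k (v : vec d) : (0 < k)%N ->
  expect (diid k m) (fun l => dot v (vscale (/ INR k) (vsum l phi))) = dot v vexpect.
Proof.
move=> k0; have kR := INR_gt0 k0.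
rewrite /dot expect_sum; apply: eq_bigr => j _.
rewrite /vscale /vsum expectZ expectZ (expect_iid_sum k (fun a => phi a j) mP) /vexpect.
by field; lra.
Qed.

End Averages.

Section FiniteSum.
Variables (d n : nat) (fs : 'I_n -> vec d -> R) (gs : 'I_n -> vec d -> vec d) (L : R).
Hypothesis n_gt0 : (0 < n)%N.
Hypothesis L_gt0 : 0 < L.
Hypothesis fgrad : forall i, is_gradient (fs i) (gs i).
Hypothesis gLip : forall i x y, norm (vsub (gs i x) (gs i y)) <= L * norm (vsub x y).
Hypothesis fconv : forall i, convex_fun (fs i).

Let unif := duniform n.
Let unifP : is_prob unif := is_prob_uniform n_gt0.

Lemma expect_uniform (F : 'I_n -> R) :
  expect unif F = / INR n * \big[Rplus/0]_(i <- enum 'I_n) F i.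
Proof. by rewrite /expect /unif /duniform big_map sum_scale. Qed.

Lemma favg_expect x : favg fs x = expect unif (fun i => fs i x).
Proof. by rewrite expect_uniform /favg enumT. Qed.

Lemma full_grad_expect x : full_grad gs x = vexpect unif (fun i => gs i x).
Proof.
by apply: functional_extensionality => j; rewrite /vexpect expect_uniform.
Qed.

Lemma favg_descent x y :
  favg fs y <= favg fs x + dot (full_grad gs x) (vsub y x)
               + L / 2 * dot (vsub y x) (vsub y x).
Proof.
rewrite !favg_expect full_grad_expect (dotC (vexpect _ _)) -expect_dot.
rewrite -(expect_const (L / 2 * _) unifP) -!expectD; apply: expect_le => // i.
by rewrite (dotC _ (gs i x)); apply: (descent (fgrad i)); [lra | exact: gLip].
Qed.

Lemma favg_gradient x y :
  favg fs x + dot (full_grad gs x) (vsub y x) <= favg fs y.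
Proof.
rewrite !favg_expect full_grad_expect (dotC (vexpect _ _)) -expect_dot.
rewrite -!expectD; apply: expect_le => // i.
by rewrite (dotC _ (gs i x)); exact: (convex_gradient (fgrad i)).
Qed.

Lemma favg_convex : convex_fun (favg fs).
Proof.
move=> x y t t01; rewrite !favg_expect -!expectZ -expectD.
by apply: expect_le => // i; exact: fconv.
Qed.

Section Estimators.
Variables (x xt : vec d).

Definition grad_diff (a : 'I_n) : vec d := vsub (gs a x) (gs a xt).
Definition full_diff : vec d := vsub (full_grad gs x) (full_grad gs xt).
Definition bregman : R :=
  favg fs xt - favg fs x - dot (full_grad gs x) (vsub xt x).

Lemma grad_diff_mean : vexpect unif grad_diff = full_diff.
Proof.
rewrite /full_diff !full_grad_expect; apply: functional_extensionality => j.
by rewrite /vexpect /vsub -expectB.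
Qed.

Lemma grad_diff_sq :
  expect unif (fun a => dot (grad_diff a) (grad_diff a)) <= 2 * L * bregman.
Proof.
rewrite /bregman !favg_expect full_grad_expect (dotC (vexpect _ _)) -expect_dot.
rewrite -!expectB -expectZ; apply: expect_le => // i.
by rewrite (dotC _ (gs i x)); apply: (cocoercive (fgrad i)).
Qed.

Lemma bregman_ge0 : 0 <= bregman.
Proof. by have := favg_gradient x xt; rewrite /bregman; lra. Qed.

Section Batch.
Variable B : nat.
Hypothesis B_gt0 : (0 < B)%N.

Let batch (I : seq 'I_n) := batch_diff gs B I x xt.
Let draws := diid B unif.
Let drawsP : is_prob draws := is_prob_iid B unifP.

Lemma batch_mean v : expect draws (fun I => dot v (batch I)) = dot v full_diff.
Proof. by rewrite -grad_diff_mean -(iid_mean grad_diff unifP v B_gt0). Qed.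

Lemma batch_sq : expect draws (fun I => dot (batch I) (batch I)) <= 2 * L * bregman.
Proof.
have sub0 (v : vec d) : vsub v (@vzero d) = v.
  by apply: functional_extensionality => j; rewrite /vsub /vzero; ring.
have := iid_mean_sq grad_diff unifP (@vzero d) B_gt0.
rewrite (expect_ext (diid B unif) (G := fun I => dot (batch I) (batch I)));
  last by move=> I; rewrite sub0.
rewrite (expect_ext unif (G := fun a => dot (grad_diff a) (grad_diff a)));
  last by move=> a; rewrite sub0.
rewrite sub0 => ->.
have h1 := vexpect_sq_le grad_diff unifP; have h2 := grad_diff_sq.
have BR := INR_gt0 B_gt0.
have B1 : / INR B <= 1.
  rewrite -Rinv_1; apply: Rinv_le_contravar; first lra.
  by apply: (le_INR 1); apply/leP.
have := Rinv_0_lt_compat _ BR; nra.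
Qed.

Lemma batch_variance :
  expect draws (fun I => dot (vsub (batch I) full_diff) (vsub (batch I) full_diff))
    <= 2 * L * bregman / INR B.
Proof.
have := iid_mean_sq grad_diff unifP full_diff B_gt0.
rewrite (expect_ext (diid B unif) (G := fun I =>
   dot (vsub (batch I) full_diff) (vsub (batch I) full_diff))) // => ->.
have BR := INR_gt0 B_gt0.
rewrite grad_diff_mean.
have -> : dot (vsub full_diff full_diff) (vsub full_diff full_diff) = 0.
  by rewrite /dot big1 // => j _; rewrite /vsub; ring.
rewrite Rmult_0_r Rplus_0_r /Rdiv (Rmult_comm _ (/ _)).
apply: Rmult_le_compat_l; first by apply: Rlt_le; exact: Rinv_0_lt_compat.
apply: Rle_trans grad_diff_sq.
have h2 := dot_ge0 full_diff.
have h : expect unif (fun a => dot (vsub (grad_diff a) full_diff)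
     (vsub (grad_diff a) full_diff)) =
  expect unif (fun a => dot (grad_diff a) (grad_diff a)) - dot full_diff full_diff.
  rewrite (expect_ext unif (G := fun a => dot (grad_diff a) (grad_diff a) -
    2 * dot full_diff (grad_diff a) + dot full_diff full_diff)).
    rewrite expectD expectB expectZ (expect_dot unif grad_diff) grad_diff_mean.
    by rewrite expect_const //; ring.
  move=> a; rewrite (dotBl (grad_diff a)) !(dotBr (grad_diff a)).
  by rewrite (dotC (grad_diff a) full_diff); ring.
by rewrite h; lra.
Qed.

Section Workers.
Variables (N b : nat) (lam dlam : R).
Hypothesis N_gt0 : (0 < N)%N.
Hypothesis b_ge2 : (2 <= b)%N.
Hypothesis lam01 : 0 < lam <= 1.
Hypothesis dlam_ge0 : 0 <= dlam.

Let step_size (u : vec d) := lam * norm_inf u / (2 ^ b.-1 - 1).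
Let quant (u : vec d) := quant_vec (step_size u) b u.
Let work := worker gs lam dlam b B x xt.
Let zetaQ := INR d * lam ^ 2 / (4 * (2 ^ b.-1 - 1) ^ 2) + dlam * (1 - lam) ^ 2.

Lemma step_size_ge0 u : 0 <= step_size u.
Proof.
have K1 := grid_size_ge1 b_ge2; have M0 := norm_inf_ge0 u.
by apply: Rmult_le_pos; [nra | apply: Rlt_le; apply: Rinv_0_lt_compat; lra].
Qed.

Lemma quantP u : is_prob (quant u).
Proof. by apply: is_prob_quant_vec; exact: step_size_ge0. Qed.

Lemma workP : is_prob work.
Proof.
apply: is_prob_bind => // I; apply: is_prob_bind => [|q]; last exact: is_prob_ret.
exact: quantP.
Qed.

Lemma zetaQ_ge0 : 0 <= zetaQ.
Proof.
have K1 := grid_size_ge1 b_ge2.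
apply: Rplus_le_le_0_compat; last by apply: Rmult_le_pos => //; nra.
apply: Rmult_le_pos; first by apply: Rmult_le_pos; [exact: pos_INR | nra].
by apply: Rlt_le; apply: Rinv_0_lt_compat; nra.
Qed.

Lemma expect_work (F : vec d -> R) : expect work (fun w => F w.1) =
  expect draws (fun I => expect (quant (batch I)) F).
Proof.
rewrite /work /worker expect_bind; apply: expect_ext => I.
by rewrite expect_bind; apply: expect_ext => q; rewrite expect_ret.
Qed.

Hypothesis flags : forall w, supp work w -> w.2 = true.

Let sq (v : vec d) := dot v v.

Lemma quant_error :
  expect draws (fun I => expect (quant (batch I)) (fun q => sq (vsub q (batch I))))
    <= zetaQ * (2 * L * bregman).
Proof.
apply: (Rle_trans _ (expect draws (fun I => zetaQ * sq (batch I)))); last first.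
  by rewrite expectZ; apply: Rmult_le_compat_l; [exact: zetaQ_ge0 | exact: batch_sq].
apply: expect_le_supp => // I suppI; apply: quant_vec_mse => //.
(* The flag is determined by the batch alone, so any possible outcome of the quantizer exhibits it
   in the support of [work]. *)
have [q qs] := supp_nonempty (quantP (batch I)).
pose fl : bool := if Rle_dec (INR (n_out (step_size (batch I)) b (batch I))) dlam
  then true else false.
have : (q, fl).2 = true.
  apply: flags.
  by apply: (supp_bind_intro suppI); apply: (supp_bind_intro qs); exact: supp_ret_self.
by rewrite /fl; case: Rle_dec.
Qed.

(** Clipping biases the quantizer, so the cross term of quantization and sampling errors need not
    vanish; splitting the square costs the factors 2. *)
Lemma work_mse : expect work (fun w => sq (vsub w.1 full_diff)) <=
  2 * (zetaQ * (2 * L * bregman)) + 2 * (2 * L * bregman / INR B).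
Proof.
rewrite (expect_work (fun q => sq (vsub q full_diff))).
apply: (Rle_trans _ (expect draws (fun I =>
  2 * expect (quant (batch I)) (fun q => sq (vsub q (batch I))) +
  2 * sq (vsub (batch I) full_diff)))).
  apply: expect_le => // I; rewrite -expectZ -(expect_const (2 * sq _) (quantP (batch I))).
  rewrite -expectD; apply: expect_le => [|q]; first exact: quantP.
  have := dot_ge0 (vsub (vsub q (batch I)) (vsub (batch I) full_diff)).
  have -> : vsub q full_diff = vadd (vsub q (batch I)) (vsub (batch I) full_diff) by vec_ring.
  rewrite /sq; move: (vsub q _) (vsub (batch I) _) => s t.
  by autorewrite with dots; rewrite (dotC t s); lra.
rewrite expectD !expectZ; apply: Rplus_le_compat; apply: Rmult_le_compat_l; try lra.
  exact: quant_error.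
exact: batch_variance.
Qed.

(** Sampling is unbiased, so the bias is that of the quantizer alone, and Jensen's inequality, used
    twice, bounds it by the quantization error. *)
Lemma work_bias : sq (vsub (vexpect work (fun w => w.1)) full_diff) <=
  zetaQ * (2 * L * bregman).
Proof.
apply: Rle_trans quant_error.
have E j : vsub (vexpect work (fun w => w.1)) full_diff j =
    expect draws (fun I => expect (quant (batch I)) (fun q => vsub q (batch I) j)).
  rewrite [LHS]/vsub /vexpect (expect_work (fun q => q j)).
  (* The unit vector reads off coordinate [j], so that the mean of the batch applies. *)
  pose e : vec d := fun i => if i == j then 1 else 0.
  have eE v : dot e v = v j.
    by rewrite /dot (bigD1 j) //= /e eqxx big1 => [|i /negbTE ->]; ring.
  rewrite -(eE full_diff) -batch_mean.
  rewrite -expectB; apply: expect_ext => I; rewrite eE.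
  rewrite -(expect_const (batch I j) (quantP (batch I))) -expectB.
  exact: expect_ext.
rewrite /sq /dot.
rewrite (expect_ext _ (G := fun I => \big[Rplus/0]_(j < d)
   expect (quant (batch I)) (fun q => vsub q (batch I) j * vsub q (batch I) j)));
  last by move=> I; rewrite expect_sum.
rewrite expect_sum; apply: sum_le => j; rewrite E.
apply: (Rle_trans _ _ _ (expect_sq_le _ drawsP)); apply: expect_le => // I.
by apply: expect_sq_le; exact: quantP.
Qed.

(** Only the sampling term gains the factor [1 / N]. The quantization term is [2 X] in the mean
    square and [X] in the squared bias, hence at most [2 X] for every [N]. *)
Lemma workers_mse :
  expect (diid N work) (fun ws =>
      sq (vsub (vscale (/ INR N) (vsum ws (fun w => w.1))) full_diff))
    <= 4 * L * (zetaQ + 1 / (INR N * INR B)) * bregman.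
Proof.
rewrite (iid_mean_sq (fun w => w.1) workP full_diff N_gt0).
have h1 := work_mse; have h2 := work_bias; rewrite /sq in h1 h2.
have NR := INR_gt0 N_gt0; have BR := INR_gt0 B_gt0.
have N1 : / INR N <= 1.
  rewrite -Rinv_1; apply: Rinv_le_contravar; first lra.
  by apply: (le_INR 1); apply/leP.
have N0 := Rinv_0_lt_compat _ NR.
have z0 := zetaQ_ge0; have D0 := bregman_ge0.
have zD : 0 <= zetaQ * (2 * L * bregman).
  by apply: Rmult_le_pos => //; apply: Rmult_le_pos => //; lra.
have -> : 4 * L * (zetaQ + 1 / (INR N * INR B)) * bregman =
  2 * (zetaQ * (2 * L * bregman)) + / INR N * (2 * (2 * L * bregman / INR B)).
  by field; lra.
set e1 := expect _ _ in h1 *; set e2 := dot _ _ in h2 *.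
have : / INR N * e1 <= / INR N * (2 * (zetaQ * (2 * L * bregman))) +
   / INR N * (2 * (2 * L * bregman / INR B)) by nra.
have : (1 - / INR N) * e2 <= (1 - / INR N) * (zetaQ * (2 * L * bregman)).
  by apply: Rmult_le_compat_l => //; lra.
nra.
Qed.

End Workers.
End Batch.
End Estimators.
End FiniteSum.

(** * One inner step *)

Section Convergence.
Variables (d n N : nat) (fs : 'I_n -> vec d -> R) (gs : 'I_n -> vec d -> vec d)
  (h : vec d -> ereal) (prox : R -> vec d -> vec d -> vec d)
  (L lam dlam : R) (b B m : nat) (xstar : vec d).
Hypothesis n_gt0 : (0 < n)%N.
Hypothesis N_gt0 : (0 < N)%N.
Hypothesis B_gt0 : (0 < B)%N.
Hypothesis b_ge2 : (2 <= b)%N.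
Hypothesis L_gt0 : 0 < L.
Hypothesis lam01 : 0 < lam <= 1.
Hypothesis dlam_ge0 : 0 <= dlam.
Hypothesis fgrad : forall i, is_gradient (fs i) (gs i).
Hypothesis gLip : forall i x y, norm (vsub (gs i x) (gs i y)) <= L * norm (vsub x y).
Hypothesis fconv : forall i, convex_fun (fs i).
Hypothesis hconv : convex_ext h.
Hypothesis proxP : is_prox h prox.
Hypothesis xminP : is_minimizer fs h xstar.

Let zeta := INR d * lam ^ 2 / (4 * (2 ^ b.-1 - 1) ^ 2)
            + dlam * (1 - lam) ^ 2 + 1 / (INR N * INR B).
Let tau2 := 5 * zeta / 3 + 1 / (2 * INR B).
Hypothesis tau2_le : tau2 <= 1 / 2.

Definition gap (x : vec d) : R := Pfin fs h x - Pfin fs h xstar.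
Definition finite (x : vec d) : Prop := h x <> None.
Definition hval (x : vec d) : R := match h x with Some a => a | None => 0 end.

Lemma finite_hval x : finite x -> h x = Some (hval x).
Proof. by rewrite /finite /hval; case: (h x). Qed.

Lemma hval_finite x a : h x = Some a -> finite x /\ hval x = a.
Proof. by rewrite /finite /hval => ->. Qed.

Lemma Pfin_finite x : finite x -> Pfin fs h x = favg fs x + hval x.
Proof. by rewrite /finite /Pfin /hval; case: (h x). Qed.

Lemma gap_ge0 x : finite x -> 0 <= gap x.
Proof. by case: xminP => _ H /H; rewrite /gap; lra. Qed.

Lemma gap_xstar : gap xstar = 0.
Proof. by rewrite /gap; ring. Qed.

Lemma finite_xstar : finite xstar.
Proof. by case: xminP. Qed.

Lemma hval_convex x y t : 0 <= t <= 1 -> finite x -> finite y ->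
  finite (vadd (vscale t x) (vscale (1 - t) y)) /\
  hval (vadd (vscale t x) (vscale (1 - t) y)) <= t * hval x + (1 - t) * hval y.
Proof.
move=> t01 /finite_hval hx /finite_hval hy.
by have [e [/hval_finite [fe ->] le]] := hconv t01 hx hy.
Qed.

Lemma gap_convex x y t : 0 <= t <= 1 -> finite x -> finite y ->
  finite (vadd (vscale t x) (vscale (1 - t) y)) /\
  gap (vadd (vscale t x) (vscale (1 - t) y)) <= t * gap x + (1 - t) * gap y.
Proof.
move=> t01 fx fy; have [fe le] := hval_convex t01 fx fy; split=> //.
have le2 := favg_convex n_gt0 fconv x y t01.
by rewrite /gap !(@Pfin_finite (vadd _ _)) // (Pfin_finite fx) (Pfin_finite fy); nra.
Qed.

Lemma finite_prox c x v : 0 < c -> finite (prox c x v).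
Proof. by move=> c0; have [hp [/hval_finite []]] := proxP x v c0. Qed.

Lemma hval_convex3 x y z t1 t2 : 0 < t1 -> 0 <= t2 -> t1 + t2 <= 1 -> t1 < 1 ->
  finite x -> finite y -> finite z ->
  let w := vadd (vadd (vscale t1 x) (vscale t2 y)) (vscale (1 - t1 - t2) z) in
  finite w /\ hval w <= t1 * hval x + t2 * hval y + (1 - t1 - t2) * hval z.
Proof.
move=> t10 t20 t12 t11 fx fy fz.
pose s := t2 / (1 - t1).
have sE : (1 - t1) * s = t2 by rewrite /s; field; lra.
have s01 : 0 <= s <= 1 by split; nra.
have [f1 l1] := hval_convex s01 fy fz.
have t01 : 0 <= t1 <= 1 by lra.
have [f2 l2] := hval_convex t01 fx f1.
have -> : vadd (vadd (vscale t1 x) (vscale t2 y)) (vscale (1 - t1 - t2) z) =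
  vadd (vscale t1 x) (vscale (1 - t1) (vadd (vscale s y) (vscale (1 - s) z))).
  by rewrite -sE; vec_ring.
split=> //=; apply: (Rle_trans _ _ _ l2).
have : (1 - t1) * hval (vadd (vscale s y) (vscale (1 - s) z)) <=
  (1 - t1) * (s * hval y + (1 - s) * hval z) by apply: Rmult_le_compat_l; lra.
rewrite -[in 1 - t1 - t2]sE -[in t2 * _]sE; lra.
Qed.

Lemma zeta_gt0 : 0 < zeta.
Proof.
have K1 := grid_size_ge1 b_ge2.
apply: Rplus_le_lt_0_compat; last first.
  apply: Rdiv_lt_0_compat; first lra.
  by apply: Rmult_lt_0_compat; exact: INR_gt0.
apply: Rplus_le_le_0_compat; last by apply: Rmult_le_pos => //; nra.
apply: Rmult_le_pos; first by apply: Rmult_le_pos; [exact: pos_INR | nra].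
by apply: Rlt_le; apply: Rinv_0_lt_compat; nra.
Qed.

Lemma tau2_gt0 : 0 < tau2.
Proof.
have := zeta_gt0; have BR := INR_gt0 B_gt0.
have : 0 < 1 / (2 * INR B) by apply: Rdiv_lt_0_compat; lra.
rewrite /tau2; lra.
Qed.

Section Pointwise.
Variables (t1 : R) (xt y z u v vh : vec d).
Hypothesis t1_bd : 0 < t1 <= 1 / 2.
Hypothesis (fxt : finite xt) (fy : finite y) (fu : finite u).

Let x := vadd (vadd (vscale t1 z) (vscale tau2 xt)) (vscale (1 - t1 - tau2) y).
Let y' := prox (2 * L) x v.
Let z' := prox (3 * L * t1) z vh.
Let w := vadd (vadd (vscale t1 z') (vscale tau2 xt)) (vscale (1 - t1 - tau2) y).
Let g := full_grad gs x.
Let sq (k : vec d) := dot k k.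

(** The quadratic terms balance exactly. Of the [2 L |y' - x|^2] gained from the first proximal
    step, [L / 2] goes to the descent inequality and [3 L / 2] to Young's inequality for [g - v]. As
    [w - x = t1 (z' - z)], comparison with [w] costs [2 L t1^2 |z' - z|^2] and Young's inequality
    for [v - vh] another [L t1^2 |z' - z|^2]; the second proximal step, scaled by [t1], supplies the
    sum. *)
Lemma step_pointwise :
  gap y' + 2 * L * sq (vsub y' w) + 3 * L * t1 ^ 2 * sq (vsub z' u) <=
  favg fs x + t1 * dot vh (vsub u z) + 3 * L * t1 ^ 2 * sq (vsub z u)
  + t1 * hval u + tau2 * hval xt + (1 - t1 - tau2) * hval y
  + sq (vsub v g) / (6 * L) + sq (vsub v vh) / (4 * L) - Pfin fs h xstar.
Proof.
have t20 := tau2_gt0.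
have c1 : 0 < 2 * L by lra.
have c2 : 0 < 3 * L * t1 by apply: Rmult_lt_0_compat; lra.
have fz' : finite z' by exact: finite_prox.
have fy' : finite y' by exact: finite_prox.
have [fw hw] : finite w /\ hval w <= t1 * hval z' + tau2 * hval xt + (1 - t1 - tau2) * hval y.
  by apply: hval_convex3 => //; lra.
have [hy' /hval_finite [_ <-]] := prox_strong hconv x v proxP c1 (finite_hval fw).
rewrite -/y' => H1.
have [hz' /hval_finite [_ <-]] := prox_strong hconv z vh proxP c2 (finite_hval fu).
rewrite -/z' => H2.
have H3 := favg_descent n_gt0 L_gt0 fgrad gLip x y'; rewrite -/g in H3.
have e0 : 0 < 3 * L / 2 by lra.
have Y1 := young (vsub y' x) (vsub g v) e0.
have Y2 := young (vscale t1 (vsub z' z)) (vsub v vh) L_gt0.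
have wx : vsub w x = vscale t1 (vsub z' z) by rewrite /w /x; vec_ring.
have ywE : dot v w = dot v y' + dot v (vsub w x) - dot v (vsub y' x).
  by rewrite 2!(dotBr _ x); ring.
rewrite ywE wx in H1.
have s1 : sq (vsub v g) = dot (vsub g v) (vsub g v).
  by rewrite /sq; autorewrite with dots; ring.
have s2 : sq (vsub y' w) = dot (vsub w y') (vsub w y').
  by rewrite /sq; autorewrite with dots; ring.
have s3 : sq (vsub z' u) = dot (vsub u z') (vsub u z').
  by rewrite /sq; autorewrite with dots; ring.
have s4 : sq (vsub z u) = dot (vsub u z) (vsub u z).
  by rewrite /sq; autorewrite with dots; ring.
rewrite /gap (Pfin_finite fy') s1 s2 s3 s4.
rewrite (dotBr g v (vsub y' x)) (dotC (vsub y' x) g) (dotC (vsub y' x) v) in Y1.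
have e1 : 4 * (3 * L / 2) = 6 * L by field.
rewrite e1 in Y1.
have {}H2 : t1 * (hval z' + dot vh z') <= 3 * L * t1 ^ 2 * dot (vsub u z) (vsub u z)
   + t1 * dot vh u + t1 * hval u
   - 3 * L * t1 ^ 2 * dot (vsub z' z) (vsub z' z)
   - 3 * L * t1 ^ 2 * dot (vsub u z') (vsub u z').
  by have := Rmult_le_compat_l t1 _ _ ltac:(lra) H2; lra.
have Q : dot (vscale t1 (vsub z' z)) (vscale t1 (vsub z' z)) =
  t1 ^ 2 * dot (vsub z' z) (vsub z' z).
  by rewrite (dotZl t1) (dotZr t1); ring.
rewrite Q in H1 Y2.
have Q2 : dot (vscale t1 (vsub z' z)) (vsub v vh) =
   t1 * (dot v (vsub z' z) - dot vh z' + dot vh z).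
  by autorewrite with dots; rewrite !(dotC _ v) !(dotC _ vh); ring.
rewrite Q2 in Y2.
rewrite (dotZr t1) in H1.
rewrite (dotBr u z vh) /sq.
move: (dot g _) (dot v _) (dot v _) H1 H2 H3 Y1 Y2 => ? ? ?; lra.
Qed.

End Pointwise.

Definition tau1 (s : nat) : R := 2 / (INR s + 4).

Lemma tau1_bd s : 0 < tau1 s <= 1 / 2.
Proof.
have s0 := pos_INR s; rewrite /tau1; split; first by apply: Rdiv_lt_0_compat; lra.
apply: (Rmult_le_reg_r (INR s + 4)); first lra.
by rewrite /Rdiv Rmult_assoc Rinv_l; lra.
Qed.

Let state := (vec d * vec d * vec d * bool)%type.
Let step s xt (st : state) : dist state := inner_step N gs prox L lam tau2 dlam b B s xt st.

Let point s xt (y z : vec d) :=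
  vadd (vadd (vscale (tau1 s) z) (vscale tau2 xt)) (vscale (1 - tau1 s - tau2) y).

Lemma prox_weight s : 1 / (2 * (1 / (6 * L * tau1 s))) = 3 * L * tau1 s.
Proof. by have t := tau1_bd s; field; lra. Qed.

Lemma workers_iid x xt :
  dseq (map (fun _ : 'I_N => worker gs lam dlam b B x xt) (enum 'I_N)) =
  diid N (worker gs lam dlam b B x xt).
Proof.
rewrite /diid; congr dseq; rewrite -[X in nseq X _](size_enum_ord N).
by elim: (enum _) => //= i l ->.
Qed.

Lemma step_expand s xt y z ys fl : step s xt (y, z, ys, fl) =
  let x := point s xt y z in
  dbind (diid N (worker gs lam dlam b B x xt)) (fun ws =>
  dbind (diid B (duniform n)) (fun J =>
    let y' := prox (2 * L) x
      (vadd (vscale (/ INR N) (vsum ws (fun w => w.1))) (full_grad gs xt)) in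
    dret (y', prox (3 * L * tau1 s) z (vadd (batch_diff gs B J x xt) (full_grad gs xt)),
          vadd ys y', fl && all (fun w => w.2) ws))).
Proof. by rewrite /step /inner_step workers_iid -/(tau1 s) prox_weight. Qed.

Lemma stepP s xt st : is_prob (step s xt st).
Proof.
move: st => [[[y z] ys] fl]; rewrite step_expand /=.
apply: is_prob_bind => [|ws]; first by apply: is_prob_iid; exact: workP.
apply: is_prob_bind => [|J]; last exact: is_prob_ret.
by apply: is_prob_iid; exact: is_prob_uniform.
Qed.

Lemma step_supp s xt y z ys fl st' : supp (step s xt (y, z, ys, fl)) st' ->
  exists y' z' fl', [/\ st' = (y', z', vadd ys y', fl && fl'), finite y' & finite z'].
Proof.
have c1 : 0 < 2 * L by lra.
have c2 : 0 < 3 * L * tau1 s by have := tau1_bd s; nra.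
have unifP := is_prob_iid B (is_prob_uniform n_gt0).
rewrite step_expand /= => H; have [||ws _ {}H] := supp_bind _ _ H.
- by apply: is_prob_iid; exact: workP.
- by move=> ws; apply: is_prob_bind => // J; exact: is_prob_ret.
case: (supp_bind unifP (fun J => is_prob_ret _) H) => J _ HJ.
rewrite (supp_ret HJ).
by eexists _, _, _; split=> //; exact: finite_prox.
Qed.

(** Any outcome of one worker extends to an outcome of the step in which it comes first, and the
    flag of the step is a conjunction containing that of the worker. *)
Lemma step_flags s xt y z ys fl w :
  (forall st', supp (step s xt (y, z, ys, fl)) st' -> out_flag st' = true) ->
  supp (worker gs lam dlam b B (point s xt y z) xt) w -> w.2 = true.
Proof.
move=> flags ws; have wP : is_prob (worker gs lam dlam b B (point s xt y z) xt) by exact: workP.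
have [N' NE] : exists N', N = N'.+1 by case: (N) N_gt0 => // N' _; exists N'.
have [l hl] := supp_iid_in N' wP ws; rewrite -NE in hl.
have [J hJ] := supp_nonempty (is_prob_iid B (is_prob_uniform n_gt0)).
have [st [/flags h1 h2]] : exists st, supp (step s xt (y, z, ys, fl)) st /\
    out_flag st = fl && (w.2 && all (fun w => w.2) l).
  rewrite step_expand; eexists; split.
    by apply: (supp_bind_intro hl); apply: (supp_bind_intro hJ); exact: supp_ret_self.
  by [].
by move: h2; rewrite h1 => /esym /andP [_ /andP []].
Qed.

(** Given the workers, [vh] has mean [g], so [|v - vh|^2] averages to [|v - g|^2] plus the batch
    variance, and [|v - g|^2] collects [1 / (6 L) + 1 / (4 L) = 5 / (12 L)]. With the bounds
    [4 L zeta D] on the first and [2 L D / B] on the second, the errors amount to exactly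
    [tau2 * D]: this is the origin of [tau2]. Convexity at [u] and [y] does the rest, the inner
    products cancelling because [x] is the combination of [z], [xt] and [y] with the same
    weights. *)
Lemma step_inequality s xt y z ys fl u :
  finite xt -> finite y -> finite u ->
  (forall st', supp (step s xt (y, z, ys, fl)) st' -> out_flag st' = true) ->
  expect (step s xt (y, z, ys, fl)) (fun st' : state => let '(y', z', _, _) := st' in
    gap y' + 2 * L * dot (vsub y' (point s xt y z')) (vsub y' (point s xt y z'))
    + 3 * L * tau1 s ^ 2 * dot (vsub z' u) (vsub z' u)) <=
  tau1 s * gap u + tau2 * gap xt + (1 - tau1 s - tau2) * gap y
  + 3 * L * tau1 s ^ 2 * dot (vsub z u) (vsub z u).
Proof.
move=> fxt fy fu flags.
have t1 := tau1_bd s; have t2 := tau2_gt0.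
have BR := INR_gt0 B_gt0.
pose x := point s xt y z; pose g := full_grad gs x; pose gt := full_grad gs xt.
pose D := bregman fs gs x xt.
have flw w : supp (worker gs lam dlam b B x xt) w -> w.2 = true by move=> hw; apply: (step_flags flags hw).
have JP := is_prob_iid B (is_prob_uniform n_gt0).
have wP : is_prob (diid N (worker gs lam dlam b B x xt)) by apply: is_prob_iid; exact: workP.
have fdE : full_diff gs x xt = vsub g gt by [].
rewrite step_expand /= expect_bind -/x -/gt.
pose vv (ws : seq (vec d * bool)) := vadd (vscale (/ INR N) (vsum ws (fun w => w.1))) gt.
pose vh J := vadd (batch_diff gs B J x xt) gt.
pose C0 := favg fs x + 3 * L * tau1 s ^ 2 * dot (vsub z u) (vsub z u)
  + tau1 s * hval u + tau2 * hval xt + (1 - tau1 s - tau2) * hval y - Pfin fs h xstar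
  + tau1 s * dot g (vsub u z) + D / (2 * INR B).
apply: (Rle_trans _ (expect (diid N (worker gs lam dlam b B x xt)) (fun ws =>
   C0 + 5 / (12 * L) * dot (vsub (vv ws) g) (vsub (vv ws) g)))).
  apply: expect_le => // ws; rewrite expect_bind.
  pose E J := batch_diff gs B J x xt.
  pose a := vsub (vv ws) g.
  pose C1 := favg fs x + 3 * L * tau1 s ^ 2 * dot (vsub z u) (vsub z u)
    + tau1 s * hval u + tau2 * hval xt + (1 - tau1 s - tau2) * hval y - Pfin fs h xstar
    + dot a a / (6 * L) + (dot a a + 2 * dot a (full_diff gs x xt)) / (4 * L)
    + tau1 s * dot gt (vsub u z).
  apply: (Rle_trans _ (expect (diid B (duniform n)) (fun J => C1
     + tau1 s * dot (vsub u z) (E J) - 2 * / (4 * L) * dot a (E J)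
     + / (4 * L) * dot (vsub (E J) (full_diff gs x xt)) (vsub (E J) (full_diff gs x xt))))).
    apply: expect_le => // J; rewrite expect_ret.
    apply: (Rle_trans _ _ _ (step_pointwise z (vv ws) (vh J) t1 fxt fy fu)).
    rewrite -/(point s xt y z) -/x -/g.
    have e1 : vsub (vv ws) (vh J) = vsub a (vsub (E J) (full_diff gs x xt)).
      by rewrite /a fdE /vh -/(E J); vec_ring.
    have e2 : dot (vh J) (vsub u z) = dot (vsub u z) (E J) + dot gt (vsub u z).
      by rewrite /vh (dotDl (batch_diff gs B J x xt)) (dotC (vsub u z)).
    rewrite e1 e2 /C1 -/a; have [k kE] : exists k, k = vsub (E J) (full_diff gs x xt) by eexists.
    rewrite -kE.
    have e3 : dot a (E J) = dot a k + dot a (full_diff gs x xt) by rewrite kE (dotBr (E J)); ring.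
    rewrite e3 !(dotBl a k) !(dotBr a k) (dotC k a).
    by apply: Req_le; field; lra.
  rewrite expectD expectB (expectD _ (fun _ => C1)) (expectZ _ (tau1 s)).
  rewrite (expectZ _ (2 * / (4 * L))) (expectZ _ (/ (4 * L))).
  rewrite !batch_mean // expect_const //.
  have V := batch_variance n_gt0 L_gt0 fgrad gLip fconv x xt B_gt0; rewrite -/D in V.
  have {}V : / (4 * L) * expect (diid B (duniform n)) (fun J =>
     dot (vsub (E J) (full_diff gs x xt)) (vsub (E J) (full_diff gs x xt))) <= D / (2 * INR B).
    have -> : D / (2 * INR B) = / (4 * L) * (2 * L * D / INR B) by field; lra.
    by apply: Rmult_le_compat_l => //; apply: Rlt_le; apply: Rinv_0_lt_compat; lra.
  have e4 : dot (vsub u z) (full_diff gs x xt) = dot g (vsub u z) - dot gt (vsub u z).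
    by rewrite fdE (dotC (vsub u z)) (dotBl g).
  rewrite e4 /C1 /C0 -/a.
  have -> : 5 / (12 * L) * dot a a = dot a a / (6 * L) + dot a a / (4 * L) by field; lra.
  have -> : (dot a a + 2 * dot a (full_diff gs x xt)) / (4 * L) =
    dot a a / (4 * L) + 2 * / (4 * L) * dot a (full_diff gs x xt) by field; lra.
  lra.
rewrite expectD expectZ expect_const //.
have W := workers_mse n_gt0 L_gt0 fgrad gLip fconv B_gt0 N_gt0 b_ge2 lam01 dlam_ge0 flw.
rewrite -/D in W.
have {}W : 5 / (12 * L) * expect (diid N (worker gs lam dlam b B x xt)) (fun ws =>
    dot (vsub (vv ws) g) (vsub (vv ws) g)) <= 5 * zeta / 3 * D.
  have -> : 5 * zeta / 3 * D = 5 / (12 * L) * (4 * L * zeta * D) by field; lra.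
  apply: Rmult_le_compat_l; first by apply: Rlt_le; apply: Rdiv_lt_0_compat; lra.
  apply: Rle_trans W; apply: Req_le; apply: expect_ext => ws.
  have -> // : vsub (vv ws) g = vsub (vscale (/ INR N) (vsum ws [eta fst])) (full_diff gs x xt).
  by rewrite fdE /vv; vec_ring.
apply: (Rle_trans _ _ _ (Rplus_le_compat_l C0 _ _ W)).
have G1 := favg_gradient n_gt0 fgrad fconv x u.
have G2 := favg_gradient n_gt0 fgrad fconv x y.
have xE : dot g x = tau1 s * dot g z + tau2 * dot g xt + (1 - tau1 s - tau2) * dot g y.
  by rewrite {1}/x /point; autorewrite with dots; ring.
rewrite -/g (dotBr u x g) in G1; rewrite -/g (dotBr y x g) in G2.
have tE : 5 * zeta / 3 * D + D / (2 * INR B) = tau2 * D by rewrite /tau2; field; lra.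
have DE : D = favg fs xt - favg fs x - (dot g xt - dot g x).
  by rewrite /D /bregman -/g (dotBr xt x g).
rewrite /C0 /gap (Pfin_finite fxt) (Pfin_finite fy) (Pfin_finite fu) (dotBr u z g).
have b0 : 0 <= 1 - tau1 s - tau2 by lra.
have := Rmult_le_compat_l _ _ _ b0 G2.
have t10 : 0 <= tau1 s by lra.
have := Rmult_le_compat_l _ _ _ t10 G1.
have : tau2 * D = tau2 * favg fs xt - tau2 * favg fs x - tau2 * dot g xt + tau2 * dot g x.
  by rewrite DE; ring.
move: xE tE; move: (tau2 * D) (5 * zeta / 3 * D) (D / _) => D1 D2 D3 xE tE D1E h1 h2.
nra.
Qed.

(** * Potentials along a run *)

(* The epigraph of the perspective [(M, v) |-> M * gap (v / M)], a convex cone. *)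
Definition epi (M : R) (v : vec d) (rho : R) : Prop :=
  (M = 0 /\ v = @vzero d /\ 0 <= rho) \/
  (0 < M /\ finite (vscale (/ M) v) /\ M * gap (vscale (/ M) v) <= rho).

Lemma vscale1 (v : vec d) : vscale 1 v = v.
Proof. by vec_ring. Qed.

Lemma epi_point x : finite x -> epi 1 x (gap x).
Proof.
by move=> fx; right; rewrite Rinv_1 vscale1; split; [lra | split=> //; lra].
Qed.

Lemma epi_zero : epi 0 (@vzero d) 0.
Proof. by left; split=> //; split=> //; lra. Qed.

Lemma epi_ge0 M v rho : epi M v rho -> 0 <= rho.
Proof.
case=> [[_ []] //|[M0 [/gap_ge0 g0 le]]].
by apply: Rle_trans le; apply: Rmult_le_pos; lra.
Qed.

Lemma epi_elim M v rho : 0 < M -> epi M v rho ->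
  finite (vscale (/ M) v) /\ M * gap (vscale (/ M) v) <= rho.
Proof. by move=> M0 [[E _]|[_]] //; lra. Qed.

Lemma epi_scale k M v rho : 0 <= k -> epi M v rho -> epi (k * M) (vscale k v) (k * rho).
Proof.
case=> [k0|<- /epi_ge0 _]; last first.
  left; rewrite !Rmult_0_l; split=> //; split; last lra.
  by apply: functional_extensionality => j; rewrite /vscale /vzero; ring.
case=> [[-> [-> r0]]|[M0 [fx le]]].
  left; rewrite Rmult_0_r; split=> //; split; last by apply: Rmult_le_pos; lra.
  by apply: functional_extensionality => j; rewrite /vscale /vzero; ring.
right; have kM : 0 < k * M by exact: Rmult_lt_0_compat.
have -> : vscale (/ (k * M)) (vscale k v) = vscale (/ M) v.
  by apply: functional_extensionality => j; rewrite /vscale; field; lra.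
split=> //; split=> //; rewrite Rmult_assoc; apply: Rmult_le_compat_l; lra.
Qed.

Lemma epi_add M1 v1 r1 M2 v2 r2 : epi M1 v1 r1 -> epi M2 v2 r2 ->
  epi (M1 + M2) (vadd v1 v2) (r1 + r2).
Proof.
have z0 v : vadd (@vzero d) v = v.
  by apply: functional_extensionality => j; rewrite /vadd /vzero; ring.
have z1 v : vadd v (@vzero d) = v.
  by apply: functional_extensionality => j; rewrite /vadd /vzero; ring.
case=> [[-> [-> h1]]|[M10 [f1 l1]]].
  rewrite z0 Rplus_0_l; case=> [[-> [-> h2]]|[M20 [f2 l2]]]; [left|right].
    by split=> //; split=> //; lra.
  by split=> //; split=> //; lra.
case=> [[-> [-> h2]]|[M20 [f2 l2]]]; right.
  by rewrite z1 Rplus_0_r; split=> //; split=> //; lra.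
split; first lra.
pose t := M1 / (M1 + M2).
have tE : (M1 + M2) * t = M1 by rewrite /t; field; lra.
have t01 : 0 <= t <= 1 by split; nra.
have := gap_convex t01 f1 f2.
have -> : vadd (vscale t (vscale (/ M1) v1)) (vscale (1 - t) (vscale (/ M2) v2)) =
  vscale (/ (M1 + M2)) (vadd v1 v2).
  by apply: functional_extensionality => j; rewrite /vadd /vscale /t; field; lra.
case=> f12 l12; split=> //.
have := Rmult_le_compat_l (M1 + M2) _ _ ltac:(lra) l12.
move: (gap (vscale (/ M1) v1)) (gap (vscale (/ M2) v2)) l1 l2 => p1 p2 l1 l2.
have -> : (M1 + M2) * (t * p1 + (1 - t) * p2) = M1 * p1 + M2 * p2 by rewrite /t; field; lra.
lra.
Qed.

(* [desc mu Q c]: from [mu], the potential described by [Q] is at most [c] on average.  The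
   quantification over [F] lets the value assigned to an outcome depend on the path to it. *)
Definition desc A (mu : dist A) (Q : A -> R -> Prop) (c : R) : Prop :=
  forall F, (forall a c', supp mu a -> Q a c' -> F a <= c') -> expect mu F <= c.

Lemma desc_ret A (a : A) (Q : A -> R -> Prop) c : Q a c -> desc (dret a) Q c.
Proof. by move=> q F H; rewrite expect_ret; apply: H => //; exact: supp_ret_self. Qed.

Lemma desc_bind A A' (mu : dist A) (k : A -> dist A') Q Q' c :
  desc mu Q c -> (forall a c', supp mu a -> Q a c' -> desc (k a) Q' c') ->
  desc (dbind mu k) Q' c.
Proof.
move=> H1 H2 F H; rewrite expect_bind; apply: H1 => a c' sa qa.
by apply: (H2 _ _ sa qa) => b' c'' sb; apply: H; exact: supp_bind_intro sa sb.
Qed.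

Section Repeat.
Variables (A : Type) (f : A -> dist A) (ok : A -> Prop).
Hypothesis fP : forall a, is_prob (f a).
Hypothesis ok_back : forall a a', supp (f a) a' -> ok a' -> ok a.

(** The hypothesis speaks only of the end of the run; every state has some continuation, along which
    [ok] is pulled back. *)
Lemma repeat_ok k a : (forall a', supp (drepeat k f a) a' -> ok a') -> ok a.
Proof.
elim: k a => [|k IH] a /= H; first by apply: H; exact: supp_ret_self.
have [a' sa] := supp_nonempty (fP a).
apply: (ok_back sa); apply: IH => a'' sa'; apply: H; exact: supp_bind_intro sa sa'.
Qed.

Lemma desc_repeat (Q : nat -> A -> R -> Prop) k t a c :
  (forall i a c, (t <= i < t + k)%N -> Q i a c -> (forall a', supp (f a) a' -> ok a') ->
     desc (f a) (Q i.+1) c) ->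
  Q t a c -> (forall a', supp (drepeat k f a) a' -> ok a') ->
  desc (drepeat k f a) (Q (t + k)%N) c.
Proof.
elim: k t a c => [|k IH] t a c Hs q okH /=; first by rewrite addn0; exact: desc_ret.
have okk a' : supp (f a) a' -> forall a'', supp (drepeat k f a') a'' -> ok a''.
  by move=> sa a'' sa'; apply: okH; exact: supp_bind_intro sa sa'.
rewrite addnS -addSn; apply: (desc_bind (Q := Q t.+1)).
  apply: Hs => //; first by rewrite leqnn addnS ltnS leq_addr.
  by move=> a' sa; apply: (@repeat_ok k); exact: okk.
move=> a' c' sa q'; apply: IH => // [i a1 c1 /andP [i1 i2]|]; last exact: okk.
by apply: Hs; rewrite (ltnW i1) addnS -addSn.
Qed.

Lemma supp_repeat (Q : nat -> A -> Prop) k t a a' :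
  (forall i a a', Q i a -> supp (f a) a' -> Q i.+1 a') ->
  Q t a -> supp (drepeat k f a) a' -> Q (t + k)%N a'.
Proof.
move=> Hs; elim: k t a => [|k IH] t a q /=; first by rewrite addn0 => H; rewrite (supp_ret H).
move=> H; have [||a1 s1 s2] := supp_bind _ _ H => //.
  by move=> a1; exact: is_prob_repeat.
by rewrite addnS -addSn; apply: IH s2; exact: Hs s1.
Qed.

End Repeat.

(** * Lifting potentials from steps to epochs and runs *)

Hypothesis m_gt0 : (0 < m)%N.

Let run_epoch s (st : state) : dist state := epoch N gs prox L lam tau2 dlam b B m s st.
Let run_outer s k (st : state) : dist state := outer N gs prox L lam tau2 dlam b B m s k st.
Let flagged (mu : dist state) := forall st, supp mu st -> out_flag st = true.

Lemma step_flag_back s xt st st' :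
  supp (step s xt st) st' -> out_flag st' = true -> out_flag st = true.
Proof.
move: st => [[[y z] ys] fl] /step_supp [y' [z' [fl' [-> _ _]]]] /=.
by case: fl.
Qed.

Lemma epochP s st : is_prob (run_epoch s st).
Proof.
move: st => [[[xt y] z] fl]; apply: is_prob_bind.
  by apply: is_prob_repeat => st; exact: stepP.
by move=> [[[y' z'] ys] fl']; exact: is_prob_ret.
Qed.

Lemma outerP s k st : is_prob (run_outer s k st).
Proof.
elim: k s st => [|k IH] s st; first exact: is_prob_ret.
by apply: is_prob_bind => [|st']; [exact: epochP | exact: IH].
Qed.

Lemma epoch_supp s xt y z fl st' : supp (run_epoch s (xt, y, z, fl)) st' ->
  exists y' z' ys fl', supp (drepeat m (step s xt) (y, z, @vzero d, fl)) (y', z', ys, fl') /\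
    st' = (vscale (/ INR m) ys, y', z', fl').
Proof.
move=> H; have [||[[[y' z'] ys] fl'] s1 s2] := supp_bind _ _ H.
- by apply: is_prob_repeat => st; exact: stepP.
- by move=> [[[y' z'] ys] fl']; exact: is_prob_ret.
by exists y', z', ys, fl'; split=> //; exact: supp_ret s2.
Qed.

Lemma epoch_flagged s xt y z fl : flagged (run_epoch s (xt, y, z, fl)) ->
  flagged (drepeat m (step s xt) (y, z, @vzero d, fl)).
Proof.
move=> H [[[y' z'] ys] fl'] s1.
apply: (H (vscale (/ INR m) ys, y', z', fl')).
by apply: (supp_bind_intro s1); exact: supp_ret_self.
Qed.

Lemma epoch_flag_back s st st' :
  supp (run_epoch s st) st' -> out_flag st' = true -> out_flag st = true.
Proof.
move: st => [[[xt y] z] fl] /epoch_supp [y' [z' [ys [fl' [s1 ->]]]]] /= fl'1.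
case: fl s1 => // s1.
have : out_flag (y', z', ys, fl') = false.
  apply: (@supp_repeat _ (step s xt) (@stepP s xt) (fun _ st => out_flag st = false) m 0) s1 => //.
  move=> _ [[[y1 z1] ys1] fl1] st1 /= -> /step_supp [? [? [? [-> _ _]]]] //.
by rewrite /= fl'1.
Qed.

Lemma outer_flagged_start s k st : flagged (run_outer s k st) -> out_flag st = true.
Proof.
elim: k s st => [|k IH] s st H; first by apply: H; exact: supp_ret_self.
have [st' s1] := supp_nonempty (epochP s st).
apply: (epoch_flag_back s1); apply: (IH s.+1) => st'' s2; apply: H.
exact: supp_bind_intro s1 s2.
Qed.

Lemma desc_epoch s xt y z fl c (In : nat -> state -> R -> Prop) (Out : state -> R -> Prop) :
  (forall t st c, (t < m)%N -> In t st c -> flagged (step s xt st) ->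
     desc (step s xt st) (In t.+1) c) ->
  (forall y z ys fl c, In m (y, z, ys, fl) c -> Out (vscale (/ INR m) ys, y, z, fl) c) ->
  In 0%N (y, z, @vzero d, fl) c -> flagged (run_epoch s (xt, y, z, fl)) ->
  desc (run_epoch s (xt, y, z, fl)) Out c.
Proof.
move=> Hs Hout I0 flg; apply: (desc_bind (Q := In m)); last first.
  by move=> [[[y' z'] ys] fl'] c' _ q; apply: desc_ret; exact: Hout.
apply: (@desc_repeat _ (step s xt) (fun st => out_flag st = true) (@stepP s xt)
  (@step_flag_back s xt) In m 0) I0 (epoch_flagged flg).
by move=> t st c' /andP [_ tm]; exact: Hs.
Qed.

Lemma desc_outer (Q : nat -> state -> R -> Prop) k s st c :
  (forall i st c, (s <= i < s + k)%N -> Q i st c -> flagged (run_epoch i st) ->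
     desc (run_epoch i st) (Q i.+1) c) ->
  Q s st c -> flagged (run_outer s k st) -> desc (run_outer s k st) (Q (s + k)%N) c.
Proof.
elim: k s st c => [|k IH] s st c Hs q flg /=; first by rewrite addn0; exact: desc_ret.
have flg' st' : supp (run_epoch s st) st' -> flagged (run_outer s.+1 k st').
  by move=> s1 st'' s2; apply: flg; exact: supp_bind_intro s1 s2.
rewrite addnS -addSn; apply: (desc_bind (Q := Q s.+1)).
  apply: Hs => //; first by rewrite leqnn addnS ltnS leq_addr.
  by move=> st' s1; exact: outer_flagged_start (flg' _ s1).
move=> st' c' s1 q'; apply: IH => // [i st1 c1 /andP [i1 i2]|]; last exact: flg'.
by apply: Hs; rewrite (ltnW i1) addnS -addSn.
Qed.

Lemma epoch_finite s xt y z fl st' : finite y ->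
  supp (run_epoch s (xt, y, z, fl)) st' ->
  finite (out_x st') /\ finite (let '(_, y', _, _) := st' in y').
Proof.
move=> fy /epoch_supp [y' [z' [ys [fl' [s1 ->]]]]] /=.
pose Q t (st : state) := let '(y, _, ys, _) := st in
  finite y /\ exists rho, epi (INR t) ys rho.
have [fy' [rho e]] : Q m (y', z', ys, fl').
  apply: (@supp_repeat _ (step s xt) (@stepP s xt) Q m 0) s1; last first.
    by split=> //; exists 0; exact: epi_zero.
  move=> t [[[y1 z1] ys1] fl1] st1 [fy1 [rho e]] /step_supp [y2 [z2 [? [-> fy2 _]]]].
  split=> //; exists (rho + gap y2); rewrite S_INR; apply: epi_add => //; exact: epi_point.
by split=> //; case: (epi_elim (INR_gt0 m_gt0) e).
Qed.

Lemma outer_finite s k xt y z fl st' : finite xt -> finite y ->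
  supp (run_outer s k (xt, y, z, fl)) st' -> finite (out_x st').
Proof.
elim: k s xt y z fl => [|k IH] s xt y z fl fx fy /=; first by move=> H; rewrite (supp_ret H).
move=> H.
case: (supp_bind (epochP s (xt, y, z, fl)) (outerP s.+1 k) H) => [[[[x1 y1] z1] fl1] s1 s2].
by have [f1 f2] := epoch_finite fy s1; apply: IH s2.
Qed.

(** The potential does not increase on average, so each inner iterate satisfies the bound in
    expectation, and the snapshot averages the iterates. As the potential depends on the path, this
    averaging is itself written as a potential. *)
Lemma desc_average s xt y z fl c g (In : nat -> state -> R -> Prop) : 0 < g ->
  (forall t st c, (t < m)%N -> In t st c -> flagged (step s xt st) ->
     desc (step s xt st) (In t.+1) c) ->
  (forall t y z ys fl c, (t < m)%N -> In t.+1 (y, z, ys, fl) c -> g * gap y <= c) ->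
  In 0%N (y, z, @vzero d, fl) c -> flagged (run_epoch s (xt, y, z, fl)) ->
  desc (run_epoch s (xt, y, z, fl)) (fun st c => g * gap (out_x st) <= c) c.
Proof.
move=> g0 Hs Hg I0 flg; have mR := INR_gt0 m_gt0.
(* [c'] is at least the mean of [m] terms: the scaled gaps already seen, bounded in total by
   [g * j], and the current value [c0] once for each remaining step. *)
pose In' t (st : state) c' := exists c0 j, [/\ In t st c0,
  (let '(_, _, ys, _) := st in epi (INR t) ys j) &
  g * j + (INR m - INR t) * c0 <= INR m * c'].
apply: (@desc_epoch _ _ _ _ _ _ In') => //; last first.
- exists c, 0; split=> //; first exact: epi_zero.
  by rewrite /=; lra.
- move=> y1 z1 ys fl1 c1 [c0 [j [_ e le]]] /=.
  have [_ h1] := epi_elim mR e.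
  apply: (Rmult_le_reg_l (INR m)) => //.
  by apply: Rle_trans le; nra.
move=> t [[[y1 z1] ys1] fl1] c1 tm [c0 [j [q e le]]] flg1 F HF.
have tR : INR t + 1 <= INR m by rewrite -S_INR; apply: le_INR; apply/leP.
(* This test function solves [g * j + (m - t) * c0 = m * F st] for [c0]. *)
have := Hs _ _ _ tm q flg1 (fun st => (INR m * F st - g * j) * / (INR m - INR t)) _.
rewrite (expect_ext _ (G := fun st => / (INR m - INR t) * (INR m * F st) -
   / (INR m - INR t) * (g * j))); last by move=> st; ring.
rewrite expectB !expectZ expect_const; last exact: stepP.
set E := expect _ F => H.
have {}H : / (INR m - INR t) * (INR m * E) - / (INR m - INR t) * (g * j) <= c0.
  apply: H => st c' sst q'.
  have [y2 [z2 [fl2 [stE fy2 _]]]] := step_supp sst; subst st.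
  have gy := Hg _ _ _ _ _ _ tm q'.
  have c'0 : 0 <= c' by apply: Rle_trans gy; apply: Rmult_le_pos; [lra | exact: gap_ge0].
  apply: (Rmult_le_reg_r (INR m - INR t)); first lra.
  rewrite Rmult_assoc Rinv_l; last lra.
  have : F (y2, z2, vadd ys1 y2, fl1 && fl2) <= / INR m * (g * (j + gap y2) +
      (INR m - INR t.+1) * c').
    apply: HF => //; exists c', (j + gap y2); split=> //.
      by rewrite S_INR; apply: epi_add => //; exact: epi_point.
    by rewrite -Rmult_assoc Rinv_r; lra.
  move/(Rmult_le_compat_l (INR m) _ _ ltac:(lra)).
  rewrite -Rmult_assoc Rinv_r; last lra.
  rewrite S_INR; lra.
apply: (Rmult_le_reg_l (INR m)) => //; apply: Rle_trans le.
have := Rmult_le_compat_l (INR m - INR t) _ _ ltac:(lra) H.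
have -> : (INR m - INR t) * (/ (INR m - INR t) * (INR m * E) - / (INR m - INR t) * (g * j)) =
  INR m * E - g * j by field; lra.
lra.
Qed.

Let sq (v : vec d) := dot v v.
Let after s xt y u (y' z' : vec d) := gap y' + 2 * L * sq (vsub y' (point s xt y z'))
  + 3 * L * tau1 s ^ 2 * sq (vsub z' u).
Let before s xt y z u := tau1 s * gap u + tau2 * gap xt + (1 - tau1 s - tau2) * gap y
  + 3 * L * tau1 s ^ 2 * sq (vsub z u).

Lemma step_combine s xt y z ys fl u1 u2 k0 k1 k2 (F : state -> R) :
  finite xt -> finite y -> finite u1 -> finite u2 -> 0 <= k1 -> 0 <= k2 ->
  flagged (step s xt (y, z, ys, fl)) ->
  (forall y' z' fl', finite y' ->
     supp (step s xt (y, z, ys, fl)) (y', z', vadd ys y', fl && fl') ->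
     F (y', z', vadd ys y', fl && fl') <=
       k0 + k1 * after s xt y u1 y' z' + k2 * after s xt y u2 y' z') ->
  expect (step s xt (y, z, ys, fl)) F <=
    k0 + k1 * before s xt y z u1 + k2 * before s xt y z u2.
Proof.
move=> fxt fy f1 f2 k10 k20 flg HF.
have I1 := step_inequality fxt fy f1 flg; have I2 := step_inequality fxt fy f2 flg.
pose V u (st' : state) := let '(y', z', _, _) := st' in after s xt y u y' z'.
apply: (Rle_trans _ (expect (step s xt (y, z, ys, fl)) (fun st' =>
  k0 + k1 * V u1 st' + k2 * V u2 st'))).
  apply: expect_le_supp; first exact: stepP.
  by move=> st' sst; have [y' [z' [fl' [E fy' _]]]] := step_supp sst; subst st'; exact: HF.
rewrite expectD expectD !expectZ expect_const; last exact: stepP.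
by apply: Rplus_le_compat; [apply: Rplus_le_compat_l|]; exact: Rmult_le_compat_l.
Qed.

(** The inverse of [tau1 s]. Its increment 1/2 gives [horizon s.+1 ^ 2 - horizon s.+1 <= horizon s ^
    2], which lets the potentials telescope across epochs. *)
Definition horizon (s : nat) : R := (INR s + 4) / 2.

Lemma horizon_ge2 s : 2 <= horizon s.
Proof. by have := pos_INR s; rewrite /horizon; lra. Qed.

Lemma horizonS s : horizon s.+1 = horizon s + 1 / 2.
Proof. by rewrite /horizon S_INR; field. Qed.

Lemma tau1_horizon s : tau1 s = / horizon s.
Proof. by have := pos_INR s; rewrite /tau1 /horizon => ?; field; lra. Qed.

Lemma horizon_tau1 s : horizon s * tau1 s = 1.
Proof. by have := horizon_ge2 s; rewrite tau1_horizon => ?; field; lra. Qed.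

(** * Large snapshot weight or short epochs *)

(* The first step of an epoch only consumes the smaller weight; the difference pays for
   the growth of [horizon ^ 2] at the end of the epoch. *)
Let y_weight s t := match t with
  | 0%N => (1 - tau1 s - tau2) * horizon s ^ 2
  | _ => horizon s ^ 2 - tau2 * horizon s.+1 ^ 2 end.

(** The gap of the snapshot is spent in [m] equal instalments, one per step, while each new [y] sets
    aside [tau2 * horizon s.+1 ^ 2] times its gap, collected in [j], for the next snapshot. *)
Let katyusha_in s xt t (st : state) c := let '(y, z, ys, _) := st in
  [/\ finite xt, finite y & exists2 j, epi (INR t) ys j &
   tau2 * horizon s.+1 ^ 2 * j + y_weight s t * gap y + 3 * L * sq (vsub z xstar)
   + (INR m - INR t) * (tau2 * horizon s ^ 2 * gap xt) <= c].

Let katyusha s (st : state) c := let '(xt, y, z, _) := st in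
  [/\ finite xt, finite y &
   INR m * tau2 * horizon s ^ 2 * gap xt + (1 - tau1 s - tau2) * horizon s ^ 2 * gap y
   + 3 * L * sq (vsub z xstar) <= c].

Lemma y_weight_mono s t : y_weight s 0 <= y_weight s t.
Proof.
case: t => [|t] /=; first lra.
have T2 := horizon_ge2 s; have E := horizon_tau1 s; rewrite horizonS.
have t2 := tau2_gt0.
have -> : (1 - tau1 s - tau2) * (horizon s * (horizon s * 1)) =
  (1 - tau2) * horizon s ^ 2 - horizon s.
  by have : horizon s * tau1 s * horizon s = horizon s; [rewrite E; ring | lra].
nra.
Qed.

Lemma katyusha_step s xt t st c : (t < m)%N -> katyusha_in s xt t st c ->
  flagged (step s xt st) -> desc (step s xt st) (katyusha_in s xt t.+1) c.
Proof.
move: st => [[[y z] ys] fl] tm [fxt fy [j e le]] flg F HF.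
have T2 := horizon_ge2 s; have TE := horizon_tau1 s.
have TT : horizon s ^ 2 * tau1 s ^ 2 = 1 by rewrite -Rpow_mult_distr TE; ring.
pose k0 := tau2 * horizon s.+1 ^ 2 * j
  + (INR m - INR t.+1) * (tau2 * horizon s ^ 2 * gap xt).
(* Only the minimizer serves as reference point here; the second instance gets weight zero. *)
apply: (Rle_trans _ (k0 + horizon s ^ 2 * before s xt y z xstar
  + 0 * before s xt y z xstar)).
  apply: step_combine => //; try exact: finite_xstar; try nra.
  move=> y' z' fl' fy' sst.
  apply: (Rle_trans _ (tau2 * horizon s.+1 ^ 2 * (j + gap y') + y_weight s t.+1 * gap y'
    + 3 * L * sq (vsub z' xstar) + (INR m - INR t.+1) * (tau2 * horizon s ^ 2 * gap xt))).
    apply: HF => //; split=> //; exists (j + gap y'); last lra.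
    by rewrite S_INR; apply: epi_add => //; exact: epi_point.
  rewrite /after /k0 /y_weight.
  have := dot_ge0 (vsub y' (point s xt y z')); rewrite -/(sq _).
  move: (sq (vsub y' _)) (sq (vsub z' xstar)) => a b' a0.
  have : 0 <= horizon s ^ 2 * (2 * L * a) by apply: Rmult_le_pos; nra.
  have : horizon s ^ 2 * (3 * L * tau1 s ^ 2 * b') = 3 * L * b'.
    by rewrite -[RHS]Rmult_1_l -TT; ring.
  nra.
apply: Rle_trans le; rewrite /before gap_xstar /k0 S_INR.
have := Rmult_le_compat_r _ _ _ (gap_ge0 fy) (y_weight_mono s t).
rewrite [X in X * _ <= _ -> _]/=.
move: (sq (vsub z xstar)) => b'.
have : horizon s ^ 2 * (3 * L * tau1 s ^ 2 * b') = 3 * L * b'.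
  by rewrite -[RHS]Rmult_1_l -TT; ring.
nra.
Qed.

Lemma katyusha_start s xt y z fl c : katyusha s (xt, y, z, fl) c ->
  katyusha_in s xt 0 (y, z, @vzero d, fl) c.
Proof.
case=> fxt fy le; split=> //; exists 0; first exact: epi_zero.
by rewrite /= in le *; lra.
Qed.

Lemma katyusha_epoch s st c : katyusha s st c -> flagged (run_epoch s st) ->
  desc (run_epoch s st) (katyusha s.+1) c.
Proof.
move: st => [[[xt y] z] fl] q; apply: (@desc_epoch _ _ _ _ _ _ (katyusha_in s xt)).
- exact: katyusha_step.
- move=> y' z' ys fl' c' [_ fy' [j e le]].
  have mR := INR_gt0 m_gt0; have [f1 h1] := epi_elim mR e.
  split=> //; apply: Rle_trans le.
  have T2 := horizon_ge2 s; have g0 := gap_ge0 fy'; have t2 := tau2_gt0.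
  have := Rmult_le_compat_l (tau2 * horizon s.+1 ^ 2) _ _ _ h1.
  have E := horizon_tau1 s.+1.
  have w : (1 - tau1 s.+1 - tau2) * horizon s.+1 ^ 2 <= y_weight s m.
    case: (m) m_gt0 => // m' _; rewrite /y_weight.
    have -> : (1 - tau1 s.+1 - tau2) * horizon s.+1 ^ 2 =
      (1 - tau2) * horizon s.+1 ^ 2 - horizon s.+1.
      have : horizon s.+1 * tau1 s.+1 * horizon s.+1 = horizon s.+1 by rewrite E; ring.
      lra.
    by rewrite horizonS; lra.
  have := Rmult_le_compat_r _ _ _ g0 w.
  have p0 : 0 <= tau2 * horizon s.+1 ^ 2 by apply: Rmult_le_pos; nra.
  move=> h2 /(_ p0); lra.
exact: katyusha_start.
Qed.

Lemma katyusha_init x0 fl : finite x0 ->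
  katyusha 0 (x0, x0, x0, fl) (4 * (INR m * gap x0 + L * sq (vsub x0 xstar))).
Proof.
move=> fx; split=> //; have g0 := gap_ge0 fx; have s0 := dot_ge0 (vsub x0 xstar).
have mR : 1 <= INR m by apply: (le_INR 1); apply/leP.
have -> : tau1 0 = 1 / 2 by rewrite /tau1 /=; field.
have -> : horizon 0 = 2 by rewrite /horizon /=; field.
have t2 := tau2_gt0; rewrite -/(sq _) in s0.
have : 0 <= L * sq (vsub x0 xstar) by apply: Rmult_le_pos; lra.
have : 0 <= (INR m - 1) * gap x0 by apply: Rmult_le_pos; lra.
have tg : tau2 * gap x0 <= 1 / 2 * gap x0 by apply: Rmult_le_compat_r.
have : INR m * (tau2 * gap x0) <= INR m * (1 / 2 * gap x0) by apply: Rmult_le_compat_l; lra.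
have : 0 <= tau2 * gap x0 by apply: Rmult_le_pos; lra.
lra.
Qed.

(** * Small snapshot weight *)

(* The factor 64 keeps the damping accumulated over one epoch, [m * rate], below 1 / 64. *)
Definition mass (s : nat) : R := 64 * (1 + INR m * (tau1 s + tau2)).
Definition rate (s : nat) : R := tau1 s / mass s.
(** Times [m], and up to damping, this weight of each [y] of the epoch becomes the weight of the
    next snapshot, of which every step consumes [tau2]. The surplus [tau1 s / 4] covers the damping,
    the loss [tau1 s - tau1 s.+1] between epochs, and the reserve [tau1 s.+1 / 64] per step. *)
Definition avg_weight (s : nat) : R := tau2 + tau1 s / 4.

Lemma mass_bounds s : 64 <= mass s /\ INR m * (tau1 s + tau2) <= mass s / 64.
Proof.
have t1 := tau1_bd s; have t2 := tau2_gt0; have mR := INR_gt0 m_gt0.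
have : 0 <= INR m * (tau1 s + tau2) by apply: Rmult_le_pos; lra.
by rewrite /mass; lra.
Qed.

Lemma rate_mass s : rate s * mass s = tau1 s.
Proof. by have [? _] := mass_bounds s; rewrite /rate; field; lra. Qed.

Lemma rate_bounds s : [/\ 0 < rate s, rate s <= tau1 s / 64,
  rate s * (INR m * (tau1 s + tau2)) <= tau1 s / 64 & INR m * rate s <= 1 / 64].
Proof.
have [M64 mM] := mass_bounds s; have E := rate_mass s; have t1 := tau1_bd s.
have t2 := tau2_gt0; have mR := INR_gt0 m_gt0.
have r0 : 0 < rate s by apply: Rdiv_lt_0_compat; lra.
have hr : rate s * (INR m * (tau1 s + tau2)) <= tau1 s / 64.
  by have := Rmult_le_compat_l _ _ _ (Rlt_le _ _ r0) mM; lra.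
split=> //; first nra.
apply: (Rmult_le_reg_r (tau1 s)); first lra.
have : 0 <= rate s * INR m * tau2 by apply: Rmult_le_pos; [apply: Rmult_le_pos|]; lra.
lra.
Qed.

(* Nonnegative weights on the current [y], on the running sum of the epoch, on the
   snapshot, and on a remainder vector; [jj] and [rho] bound the gaps they carry. *)
Record anchor := Anchor { be : R; al : R; th : R; mu : R; rr : vec d; rho : R; jj : R }.

Definition anchor_vec (A : anchor) (y ys xt : vec d) : vec d :=
  vadd (vadd (vadd (vscale (be A) y) (vscale (al A) ys)) (vscale (th A) xt)) (rr A).
Definition anchor_val (A : anchor) (y xt : vec d) : R :=
  be A * gap y + al A * jj A + th A * gap xt + rho A.

(** The third clause keeps nonnegative the weight of [y] that the next step moves into the
    remainder. The lower bound on [th A] pays, for each remaining step, the [tau2] and a damping of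
    at most [tau1 s / 64]. After a step the newest [y] has total coefficient 1, shared between
    [be A] and its place in [ys]; at [t = 0] the sum [ys] is empty and no such relation is
    required. *)
Definition anchor_ok s t (ys : vec d) (A : anchor) : Prop :=
  [/\ epi (INR t) ys (jj A), epi (mu A) (rr A) (rho A),
      1 - tau1 s - tau2 <= (1 - rate s) * be A,
      0 <= al A /\ avg_weight s * (1 - INR t * rate s) <= al A <= avg_weight s &
      [/\ (INR m - INR t) * (tau2 + tau1 s / 64) <= th A <= INR m * (tau1 s + tau2),
          (0 < t)%N -> be A = 1 - al A &
          be A + al A * INR t + th A + mu A = mass s]].

Section AnchorStep.
Variables (s t : nat) (xt y ys : vec d) (A : anchor).
Hypothesis tm : (t <= m)%N.
Hypothesis (fxt : finite xt) (fy : finite y).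
Hypothesis ok : anchor_ok s t ys A.

Lemma be_ge0 : 0 <= be A.
Proof.
have [_ _ h1 _ _] := ok; have [r0 r1 _ _] := rate_bounds s; have t1 := tau1_bd s.
apply: (Rmult_le_reg_l (1 - rate s)); first lra.
by rewrite Rmult_0_r; apply: Rle_trans h1; lra.
Qed.

Lemma th_ge0 : 0 <= th A.
Proof.
have [_ _ _ _ [[h1 _] _ _]] := ok; apply: Rle_trans h1; apply: Rmult_le_pos.
  have : INR t <= INR m by apply: le_INR; apply/leP.
  lra.
by have := tau1_bd s; have := tau2_gt0; lra.
Qed.

Lemma anchor_epi : epi (mass s) (anchor_vec A y ys xt) (anchor_val A y xt).
Proof.
have [e1 e2 _ [a0 _] [_ _ <-]] := ok.
apply: epi_add => //; apply: epi_add; last first.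
  by have := epi_scale th_ge0 (epi_point fxt); rewrite Rmult_1_r.
apply: epi_add; last exact: epi_scale.
by have := epi_scale be_ge0 (epi_point fy); rewrite Rmult_1_r.
Qed.

(* Chosen so that the anchor moves to [(1 - rate) U + rate z'], up to the error [y' - w]. *)
Definition anchor_next (gy' : R) : anchor :=
  let k := (1 - rate s) * be A - (1 - tau1 s - tau2) in
  Anchor (1 - (1 - rate s) * al A) ((1 - rate s) * al A) ((1 - rate s) * th A - tau2)
    ((1 - rate s) * mu A + k) (vadd (vscale (1 - rate s) (rr A)) (vscale k y))
    ((1 - rate s) * rho A + k * gap y) (jj A + gy').

Lemma anchor_next_ok y' : (t < m)%N -> finite y' ->
  anchor_ok s t.+1 (vadd ys y') (anchor_next (gap y')).
Proof.
move=> tm' fy'; have [r0 r1 r2 r3] := rate_bounds s.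
have t1 := tau1_bd s; have t2 := tau2_gt0.
have [e1 e2 h1 [a0 [a1 a2]] [[th1 th2] _ sumE]] := ok.
have tR : INR t + 1 <= INR m by rewrite -S_INR; apply: le_INR; apply/leP.
have tR0 := pos_INR t.
have w0 : 0 <= avg_weight s by rewrite /avg_weight; lra.
have tr : INR t.+1 * rate s <= 1 by rewrite S_INR; nra.
split; rewrite /anchor_next /=.
- by rewrite -/(INR t.+1) S_INR; apply: epi_add => //; exact: epi_point.
- apply: epi_add; first by apply: epi_scale => //; lra.
  set k := _ - _; have k0 : 0 <= k by rewrite /k; lra.
  by have := epi_scale k0 (epi_point fy); rewrite Rmult_1_r.
- have : rate s * al A <= rate s * avg_weight s by apply: Rmult_le_compat_l; lra.
  have : (1 - rate s) * al A <= avg_weight s by nra.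
  by rewrite /avg_weight; nra.
- split; first by apply: Rmult_le_pos; lra.
  rewrite -/(INR t.+1) S_INR; split; last by nra.
  have : (1 - rate s) * (avg_weight s * (1 - INR t * rate s)) <= (1 - rate s) * al A.
    by apply: Rmult_le_compat_l; lra.
  (* The term dropped in Bernoulli's inequality [(1 - r) (1 - t r) >= 1 - (t + 1) r]. *)
  have : 0 <= avg_weight s * (rate s * (INR t * rate s)).
    apply: Rmult_le_pos => //; apply: Rmult_le_pos; first lra.
    by apply: Rmult_le_pos; lra.
  lra.
split=> //.
- rewrite -/(INR t.+1) S_INR.
  have : rate s * th A <= tau1 s / 64.
    by apply: Rle_trans r2; apply: Rmult_le_compat_l; lra.
  have : 0 <= rate s * th A by apply: Rmult_le_pos; [lra | exact: th_ge0].
  lra.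
- rewrite -/(INR t.+1) S_INR.
  have E := rate_mass s; rewrite -sumE in E.
  by rewrite -sumE; lra.
Qed.

Lemma anchor_next_vec y' : anchor_vec (anchor_next (gap y')) y' (vadd ys y') xt =
  vadd (vscale (1 - rate s) (anchor_vec A y ys xt))
    (vsub y' (vadd (vscale tau2 xt) (vscale (1 - tau1 s - tau2) y))).
Proof. by rewrite /anchor_vec /anchor_next /=; vec_ring. Qed.

Lemma anchor_next_val y' : anchor_val (anchor_next (gap y')) y' xt =
  (1 - rate s) * anchor_val A y xt + gap y' - (1 - tau1 s - tau2) * gap y - tau2 * gap xt.
Proof. by rewrite /anchor_val /anchor_next /=; ring. Qed.

(** As [rate s * mass s = tau1 s], the vector [z' - u'] is the convex combination of [z' - u] and
    [- e / tau1 s], with [e] the error [y' - w], where the second has weight [rate s]; the square is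
    convex. *)
Lemma anchor_contract y' z' :
  let u := vscale (/ mass s) (anchor_vec A y ys xt) in
  let u' := vscale (/ mass s) (anchor_vec (anchor_next (gap y')) y' (vadd ys y') xt) in
  tau1 s ^ 2 * sq (vsub z' u') <= (1 - rate s) * (tau1 s ^ 2 * sq (vsub z' u))
    + rate s * sq (vsub y' (point s xt y z')).
Proof.
move=> u u'; have [r0 r1 r2 r3] := rate_bounds s.
have [M64 _] := mass_bounds s; have t1 := tau1_bd s.
set e := vsub y' (point s xt y z').
have -> : vsub z' u' = vsub (vscale (1 - rate s) (vsub z' u)) (vscale (/ mass s) e).
  rewrite /u' anchor_next_vec /u /e /point; apply: functional_extensionality => j.
  by rewrite /vadd /vsub /vscale /rate; field; lra.
have [p pE] : exists p, p = vsub z' u by eexists.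
have [q qE] : exists q, q = e by eexists.
rewrite -/(sq q) -pE -qE.
have := dot_ge0 (vadd (vscale (tau1 s) p) q).
rewrite /sq; autorewrite with dots; rewrite (dotC q p) => H.
have ME : / mass s = rate s * / tau1 s by rewrite /rate; field; lra.
rewrite ME.
have -> : tau1 s ^ 2 * ((1 - rate s) * ((1 - rate s) * dot p p)
   - (1 - rate s) * (rate s * / tau1 s * dot p q)
   - (rate s * / tau1 s * ((1 - rate s) * dot p q)
   - rate s * / tau1 s * (rate s * / tau1 s * dot q q))) =
  (1 - rate s) * (tau1 s ^ 2 * dot p p) + rate s * dot q q -
  rate s * (1 - rate s) * (tau1 s * (tau1 s * dot p p) + tau1 s * dot p q
    + (tau1 s * dot p q + dot q q)) by field; lra.
have : 0 <= rate s * (1 - rate s) by apply: Rmult_le_pos; lra.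
move=> rr0; have := Rmult_le_pos _ _ rr0 H; lra.
Qed.

End AnchorStep.

(* 577 is a horizon beyond which an epoch raises [growth] faster than [2 * horizon ^ 2]. *)
Fixpoint growth (s : nat) : R := match s with
  | 0%N => 2 * 577 ^ 2
  | s'.+1 => growth s' + INR m * (horizon s' / mass s')
  end.

Lemma ratio_ge0 s : 0 < horizon s / mass s.
Proof.
have [M64 _] := mass_bounds s; have T2 := horizon_ge2 s.
by apply: Rdiv_lt_0_compat; lra.
Qed.

(** This bound brings the factor [m] into the rate. Since [mass * horizon] is nondecreasing, the
    induction step reduces to [(T + 1 / 2)^3 <= T (T^2 + 2 T)], true for [T = horizon s >= 2]. *)
Lemma growth_mass s : INR m * (horizon s ^ 2 / (2 * mass s)) <= growth s.
Proof.
have mR := INR_gt0 m_gt0.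
elim: s => [|s IH].
  have [M64 mM] := mass_bounds 0.
  have t0 : tau1 0 = 1 / 2 by rewrite /tau1 /=; field.
  have h0 : horizon 0 = 2 by rewrite /horizon /=; field.
  have t2 := tau2_gt0; rewrite h0 [growth 0]/=.
  apply: (Rmult_le_reg_r (mass 0)); first lra.
  have -> : INR m * (2 ^ 2 / (2 * mass 0)) * mass 0 = 2 * INR m by field; lra.
  rewrite t0 in mM; have : 0 <= INR m * tau2 by apply: Rmult_le_pos; lra.
  lra.
rewrite [growth s.+1]/=; apply: (Rle_trans _ (INR m * (horizon s ^ 2 / (2 * mass s))
  + INR m * (horizon s / mass s))); last lra.
rewrite -Rmult_plus_distr_l; apply: Rmult_le_compat_l; first lra.
have [M64 _] := mass_bounds s; have [M64' _] := mass_bounds s.+1; have T2 := horizon_ge2 s.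
have -> : horizon s ^ 2 / (2 * mass s) + horizon s / mass s =
  (horizon s ^ 2 + 2 * horizon s) / (2 * mass s) by field; lra.
have HM : mass s * horizon s <= mass s.+1 * horizon s.+1.
  have E := horizon_tau1 s; have E' := horizon_tau1 s.+1; have t2 := tau2_gt0.
  have -> : mass s * horizon s =
    64 * (horizon s + INR m * (horizon s * tau1 s + tau2 * horizon s)) by rewrite /mass; ring.
  have -> : mass s.+1 * horizon s.+1 =
    64 * (horizon s.+1 + INR m * (horizon s.+1 * tau1 s.+1 + tau2 * horizon s.+1)).
    by rewrite /mass; ring.
  rewrite E E' horizonS.
  have : 0 <= INR m * tau2 by apply: Rmult_le_pos; lra.
  lra.
apply: (Rmult_le_reg_r (2 * mass s * mass s.+1 * horizon s)).
  by apply: Rmult_lt_0_compat; [apply: Rmult_lt_0_compat; [lra|lra] | lra].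
have -> : horizon s.+1 ^ 2 / (2 * mass s.+1) * (2 * mass s * mass s.+1 * horizon s) =
  horizon s.+1 ^ 2 * (mass s * horizon s) by field; lra.
have -> : (horizon s ^ 2 + 2 * horizon s) / (2 * mass s) * (2 * mass s * mass s.+1 * horizon s)
  = (horizon s ^ 2 + 2 * horizon s) * horizon s * mass s.+1 by field; lra.
apply: (Rle_trans _ (horizon s.+1 ^ 2 * (mass s.+1 * horizon s.+1))).
  by apply: Rmult_le_compat_l => //; exact: pow2_ge_0.
have -> : horizon s.+1 ^ 2 * (mass s.+1 * horizon s.+1) = horizon s.+1 ^ 3 * mass s.+1 by ring.
apply: Rmult_le_compat_r; first lra.
by rewrite horizonS; nra.
Qed.

Let gain s t := growth s + INR t * (horizon s / mass s).

(** The coefficient [gain s t.+1 - horizon s ^ 2] is the weight with which the next step uses the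
    anchor as reference point, the other [horizon s ^ 2] going to the minimizer. *)
Let anchored_in s xt t (st : state) c := let '(y, z, ys, _) := st in
  [/\ finite xt, finite y & exists2 A, anchor_ok s t ys A &
   gain s t * anchor_val A y xt
   + (gain s t.+1 - horizon s ^ 2)
     * (3 * L * (tau1 s ^ 2 * sq (vsub z (vscale (/ mass s) (anchor_vec A y ys xt)))))
   + 3 * L * sq (vsub z xstar) <= c].

Let anchored s (st : state) c := let '(xt, y, z, fl) := st in
  anchored_in s xt 0 (y, z, @vzero d, fl) c.

Section SmallSnapshotWeight.
Hypothesis m_large : 288 <= INR m.
Hypothesis tau2_small : tau2 <= 1 / 576.

(** This leaves the anchor at least the weight [horizon s ^ 2], as the damping requires. It is free
    while the horizon is at most 577. Beyond, [tau1 s] and [tau2] are at most [1 / 576] and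
    [1 <= m / 288], so [mass s <= 4 m / 9] and the epoch adds at least [9 / 4 * horizon s], which
    covers the increase [2 * horizon s + 1 / 2] of [2 * horizon s ^ 2]. *)
Lemma growth_ge s : 2 * horizon s ^ 2 <= growth s.
Proof.
suff [] : 2 * 577 ^ 2 <= growth s /\ 2 * horizon s ^ 2 <= growth s by [].
elim: s => [|s [IH1 IH2]].
  by rewrite /horizon /=; lra.
have ra := ratio_ge0 s; have T2 := horizon_ge2 s; have [M64 mM] := mass_bounds s.
have up : growth s <= growth s.+1.
  have : 0 <= INR m * (horizon s / mass s) by apply: Rmult_le_pos; lra.
  by rewrite /=; lra.
split; first lra.
case: (Rle_lt_dec (horizon s.+1) 577) => [T577|T577].
  by apply: Rle_trans up; apply: Rle_trans IH1; have := horizon_ge2 s.+1; nra.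
rewrite horizonS in T577 *.
have t1 : tau1 s <= 1 / 576.
  have := horizon_tau1 s; have [t0 _] := tau1_bd s; nra.
have mm : 9 / 4 * mass s <= INR m.
  have : INR m * (tau1 s + tau2) <= INR m * (1 / 288) by apply: Rmult_le_compat_l; lra.
  by rewrite /mass; lra.
have : 9 / 4 * horizon s <= INR m * (horizon s / mass s).
  have -> : 9 / 4 * horizon s = 9 / 4 * mass s * (horizon s / mass s) by field; lra.
  by apply: Rmult_le_compat_r; lra.
rewrite /=; lra.
Qed.

Lemma gainS s t : gain s t.+1 = gain s t + horizon s / mass s.
Proof. by rewrite /gain S_INR; ring. Qed.

Lemma gain_ge s t : growth s <= gain s t.
Proof.
have r0 := ratio_ge0 s; have := pos_INR t; rewrite /gain => t0.
have : 0 <= INR t * (horizon s / mass s) by apply: Rmult_le_pos; lra.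
lra.
Qed.

Lemma horizon_rate s : horizon s ^ 2 * rate s = horizon s / mass s.
Proof.
have [M64 _] := mass_bounds s; have T2 := horizon_ge2 s.
by rewrite /rate tau1_horizon; field; lra.
Qed.

(** The weights [horizon s ^ 2] at [xstar] and [lm] at [u] add up to [G1], so the gaps in
    [anchor_next_val] cancel. The charge [lm * tau1 s * gap u] is at most [lm * rate s * pi], while
    damping frees [G1 * rate s * pi]; the surplus [horizon s ^ 2 * rate s = horizon s / mass s] is
    what raises [gain s t] to [G1]. *)
Lemma anchored_step s xt t st c : (t < m)%N -> anchored_in s xt t st c ->
  flagged (step s xt st) -> desc (step s xt st) (anchored_in s xt t.+1) c.
Proof.
move: st => [[[y z] ys] fl] tm [fxt fy [A ok le]] flg F HF.
have tm' := ltnW tm.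
have [r0 r1 r2 r3] := rate_bounds s; have t1 := tau1_bd s.
have [M64 _] := mass_bounds s; have M0 : 0 < mass s by lra.
have T2 := horizon_ge2 s; have TE := horizon_tau1 s.
have TT : horizon s ^ 2 * tau1 s ^ 2 = 1 by rewrite -Rpow_mult_distr TE; ring.
have rat := ratio_ge0 s; have Tr := horizon_rate s.
set pi := anchor_val A y xt in le.
set u := vscale (/ mass s) (anchor_vec A y ys xt) in le.
have [fu gu] := epi_elim M0 (anchor_epi tm' fxt fy ok); rewrite -/u -/pi in fu gu.
have pi0 : 0 <= pi by exact: epi_ge0 (anchor_epi tm' fxt fy ok).
set G1 := gain s t.+1 in le.
have GE : gain s t = G1 - horizon s / mass s by rewrite /G1 gainS; ring.
have G2 : 2 * horizon s ^ 2 <= G1 by apply: Rle_trans (gain_ge _ _); exact: growth_ge.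
have G3 : gain s t.+2 = G1 + horizon s / mass s by rewrite gainS.
pose k0 := G1 * ((1 - rate s) * pi - (1 - tau1 s - tau2) * gap y - tau2 * gap xt).
pose lm := G1 - horizon s ^ 2.
have lm0 : horizon s ^ 2 <= lm by rewrite /lm; lra.
have TT4 : 4 <= horizon s ^ 2 by nra.
apply: (Rle_trans _ (k0 + horizon s ^ 2 * before s xt y z xstar + lm * before s xt y z u)).
  apply: step_combine => //; try exact: finite_xstar; try lra.
  move=> y' z' fl' fy' sst.
  apply: (Rle_trans _ (G1 * anchor_val (anchor_next s y A (gap y')) y' xt
   + (gain s t.+2 - horizon s ^ 2)
     * (3 * L * (tau1 s ^ 2 * sq (vsub z' (vscale (/ mass s)
         (anchor_vec (anchor_next s y A (gap y')) y' (vadd ys y') xt)))))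
   + 3 * L * sq (vsub z' xstar))).
    apply: HF => //; split=> //; exists (anchor_next s y A (gap y')); last by apply: Rle_refl.
    exact: anchor_next_ok.
  rewrite anchor_next_val -/pi G3.
  have := anchor_contract s xt y ys A y' z'; rewrite -/u.
  set K' := tau1 s ^ 2 * sq (vsub z' (vscale _ _)); set K := tau1 s ^ 2 * sq (vsub z' u).
  rewrite /after; have := dot_ge0 (vsub y' (point s xt y z')); rewrite -/(sq _).
  move: (sq (vsub y' _)) (sq (vsub z' xstar)) => a b' a0 HK.
  have -> : horizon s ^ 2 * (gap y' + 2 * L * a + 3 * L * tau1 s ^ 2 * b') =
    horizon s ^ 2 * (gap y' + 2 * L * a) + 3 * L * b' by rewrite -[X in _ = _ + X]Rmult_1_l -TT; ring.
  have -> : lm * (gap y' + 2 * L * a + 3 * L * tau1 s ^ 2 * sq (vsub z' u)) =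
    lm * (gap y' + 2 * L * a) + lm * (3 * L * K) by rewrite /K; ring.
  have K0 : 0 <= K by apply: Rmult_le_pos; [nra | exact: dot_ge0].
  have lE : horizon s ^ 2 = G1 - lm by rewrite /lm; ring.
  (* Multiplied by [3 * L], the last term is [2 * L * G1 * a], the proximal slack available from
     both instances. *)
  suff : (lm + horizon s / mass s) * K' <= lm * K + 2 / 3 * G1 * a.
    move/(Rmult_le_compat_l (3 * L) _ _ ltac:(lra)); rewrite /k0 lE; lra.
  have cl : 0 <= lm + horizon s / mass s by lra.
  apply: (Rle_trans _ ((lm + horizon s / mass s) * ((1 - rate s) * K + rate s * a))).
    exact: Rmult_le_compat_l.
  (* Damping offsets the increase [horizon s ^ 2 * rate s] of the weight because [lm] is at least
     [horizon s ^ 2]. *)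
  have h1 : (lm + horizon s / mass s) * (1 - rate s) <= lm.
    have : horizon s ^ 2 * rate s <= lm * rate s by apply: Rmult_le_compat_r; lra.
    have : 0 <= horizon s / mass s * rate s by apply: Rmult_le_pos; lra.
    lra.
  have h2 : (lm + horizon s / mass s) * rate s <= 2 / 3 * G1.
    have : horizon s / mass s <= horizon s ^ 2 by rewrite -Tr; nra.
    by rewrite /lm; nra.
  have := Rmult_le_compat_r _ _ _ K0 h1; have := Rmult_le_compat_r _ _ _ a0 h2; lra.
apply: Rle_trans le; rewrite GE /before gap_xstar /k0.
have h3 : tau1 s * gap u <= rate s * pi.
  rewrite -(rate_mass s) Rmult_assoc; apply: Rmult_le_compat_l; lra.
move/(Rmult_le_compat_l lm _ _ ltac:(lra)): h3.
move: (sq (vsub z xstar)) (sq (vsub z u)) => b' a.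
have : horizon s ^ 2 * (3 * L * tau1 s ^ 2 * b') = 3 * L * b'.
  by rewrite -[RHS]Rmult_1_l -TT; ring.
rewrite -Tr /lm; lra.
Qed.

Lemma tau1S s : [/\ 0 < tau1 s.+1, tau1 s - tau1 s.+1 = tau1 s * tau1 s.+1 / 2,
  tau1 s.+1 <= tau1 s & tau1 s <= 5 / 4 * tau1 s.+1].
Proof.
have T2 := horizon_ge2 s; have [t0 t1] := tau1_bd s; have [t0' t1'] := tau1_bd s.+1.
have E : tau1 s - tau1 s.+1 = tau1 s * tau1 s.+1 / 2.
  by rewrite !tau1_horizon horizonS; field; lra.
have p : 0 < tau1 s * tau1 s.+1 by apply: Rmult_lt_0_compat.
by split=> //; nra.
Qed.

(** The mass shrinks with [tau1], so the anchor vector is rescaled by [ga], which leaves the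
    reference point in place. The sum [ys] is [m] times the new snapshot and turns into its weight;
    the old snapshot joins the remainder. *)
Lemma anchored_boundary s xt y z ys fl c : anchored_in s xt m (y, z, ys, fl) c ->
  anchored s.+1 (vscale (/ INR m) ys, y, z, fl) c.
Proof.
case=> fxt fy [A ok le]; have mR := INR_gt0 m_gt0.
have th0 := th_ge0 (leqnn m) ok; have be0 := be_ge0 ok.
have val0 := epi_ge0 (anchor_epi (leqnn m) fxt fy ok).
have [e1 e2 h1 [a0 [a1 a2]] [[th1 th2] beE sumE]] := ok.
have {}beE := beE m_gt0.
have [fx' gx'] := epi_elim mR e1; set xt' := vscale _ ys in fx' gx' *.
have [t0' tE tle t54] := tau1S s; have t2 := tau2_gt0; have t1 := tau1_bd s.
have [M64 mM] := mass_bounds s; have [M64' mM'] := mass_bounds s.+1.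
have [r0 r1 r2 r3] := rate_bounds s; have [r0' r1' _ _] := rate_bounds s.+1.
pose ga := mass s.+1 / mass s.
have gaE : ga * mass s = mass s.+1 by rewrite /ga; field; lra.
have ga0 : 0 < ga by apply: Rdiv_lt_0_compat; lra.
have gaM : (1 - ga) * mass s = 64 * INR m * (tau1 s - tau1 s.+1).
  by rewrite Rmult_minus_distr_r gaE /mass; ring.
have ga1 : ga <= 1.
  have : 0 <= 64 * INR m * (tau1 s - tau1 s.+1) by apply: Rmult_le_pos; lra.
  by rewrite -gaM => H; have := Rmult_le_reg_r (mass s) 0 (1 - ga) ltac:(lra); lra.
have ga2 : 1 - ga <= tau1 s.+1 / 2.
  apply: (Rmult_le_reg_r (mass s)); first lra.
  rewrite gaM tE.
  have : INR m * tau1 s <= mass s / 64.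
    by apply: Rle_trans mM; apply: Rmult_le_compat_l; lra.
  by move/(Rmult_le_compat_l (32 * tau1 s.+1) _ _ ltac:(lra)); lra.
have ga3 : (1 - ga) * avg_weight s <= tau1 s - tau1 s.+1.
  apply: (Rmult_le_reg_r (mass s)); first lra.
  have -> : (1 - ga) * avg_weight s * mass s = (1 - ga) * mass s * avg_weight s by ring.
  rewrite gaM.
  have : INR m * avg_weight s <= mass s / 64.
    by apply: Rle_trans mM; apply: Rmult_le_compat_l; rewrite ?/avg_weight; lra.
  by move/(Rmult_le_compat_l (64 * (tau1 s - tau1 s.+1)) _ _ ltac:(lra)); lra.
(* The running sum restarts empty, so its weight can be reset freely. *)
pose A' := Anchor (ga * be A) (avg_weight s.+1) (ga * al A * INR m) (ga * (mu A + th A))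
  (vscale ga (vadd (rr A) (vscale (th A) xt))) (ga * (rho A + th A * gap xt)) 0.
have vE : anchor_vec A' y (@vzero d) xt' = vscale ga (anchor_vec A y ys xt).
  rewrite /anchor_vec /A' /=; apply: functional_extensionality => j.
  by rewrite /vadd /vscale /vzero /xt' /vscale; field; lra.
have uE : vscale (/ mass s.+1) (vscale ga (anchor_vec A y ys xt)) =
    vscale (/ mass s) (anchor_vec A y ys xt).
  by apply: functional_extensionality => j; rewrite /vscale /ga; field; lra.
have aw0 : 0 <= avg_weight s by rewrite /avg_weight; lra.
have aw1 : avg_weight s <= tau1 s + tau2 by rewrite /avg_weight; lra.
split=> //; exists A'.
  split; rewrite /A' /=.
  - exact: epi_zero.
  - apply: epi_scale; first lra.
    by apply: epi_add => //; have := epi_scale th0 (epi_point fxt); rewrite Rmult_1_r.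
  - rewrite beE.
    have : 1 - (1 - ga) - avg_weight s <= ga * (1 - al A) by nra.
    have b1 : ga * (1 - al A) <= 1 by nra.
    have : rate s.+1 * (ga * (1 - al A)) <= rate s.+1 * 1 by apply: Rmult_le_compat_l; lra.
    by rewrite /avg_weight; lra.
  - by rewrite Rmult_0_l Rminus_0_r Rmult_1_r; split; [rewrite /avg_weight|]; lra.
  split=> //.
  - have lo : tau2 + tau1 s.+1 / 64 <= ga * al A.
      have g1 : al A - (tau1 s - tau1 s.+1) <= ga * al A.
        have : (1 - ga) * al A <= (1 - ga) * avg_weight s by apply: Rmult_le_compat_l; lra.
        lra.
      have g2 : avg_weight s * (INR m * rate s) <= tau1 s / 64.
        apply: Rle_trans r2; rewrite (Rmult_comm (INR m)) -(Rmult_assoc (rate s)).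
        rewrite (Rmult_comm _ (rate s * INR m)); apply: Rmult_le_compat_l => //.
        by apply: Rmult_le_pos; lra.
      have : avg_weight s - tau1 s / 64 <= al A by lra.
      by rewrite /avg_weight; lra.
    have hi : ga * al A <= tau1 s.+1 + tau2.
      apply: (Rle_trans _ (1 * avg_weight s)); first by apply: Rmult_le_compat; lra.
      by rewrite /avg_weight; lra.
    split; last by rewrite Rmult_comm; apply: Rmult_le_compat_l; lra.
    by rewrite Rminus_0_r (Rmult_comm (ga * al A)); apply: Rmult_le_compat_l; lra.
  - by rewrite Rmult_0_r -gaE -sumE; ring.
apply: Rle_trans le.
rewrite vE uE; set K := sq (vsub z _); have K0 : 0 <= K by exact: dot_ge0.
have G2 := growth_ge s.+1; have T2 := horizon_ge2 s.
have GE : growth s.+1 = gain s m by [].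
have -> : gain s.+1 0 = gain s m by rewrite /gain /=; ring.
have valle : anchor_val A' y xt' <= anchor_val A y xt.
  apply: (Rle_trans _ (ga * anchor_val A y xt)).
    rewrite /anchor_val /A' /= Rmult_0_r.
    have : ga * al A * (INR m * gap xt') <= ga * al A * jj A.
      by apply: Rmult_le_compat_l => //; apply: Rmult_le_pos; lra.
    lra.
  by rewrite -[X in _ <= X]Rmult_1_l; apply: Rmult_le_compat_r.
have g0 : 0 <= gain s m by rewrite -GE; nra.
apply: Rplus_le_compat_r; apply: Rplus_le_compat; first exact: Rmult_le_compat_l.
have ra := ratio_ge0 s; have ra' := ratio_ge0 s.+1.
rewrite [gain s.+1 1]gainS [gain s m.+1]gainS.
have -> : gain s.+1 0 = gain s m by rewrite /gain /=; ring.
have ra1 : horizon s.+1 / mass s.+1 <= horizon s.+1 / 64.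
  by apply: Rmult_le_compat_l; [rewrite horizonS; lra | apply: Rinv_le_contravar; lra].
(* The squared horizon rises by [horizon s + 1 / 4], more than the new increment, which is at most
   [horizon s.+1 / 64]. *)
have c1 : gain s m + horizon s.+1 / mass s.+1 - horizon s.+1 ^ 2 <=
    gain s m + horizon s / mass s - horizon s ^ 2.
  by rewrite horizonS in ra1 *; nra.
have c0 : 0 <= gain s m + horizon s.+1 / mass s.+1 - horizon s.+1 ^ 2.
  by have := pow2_ge_0 (horizon s.+1); rewrite -GE; lra.
apply: Rmult_le_compat => //.
  by apply: Rmult_le_pos; [lra | apply: Rmult_le_pos => //; nra].
apply: Rmult_le_compat_l; first lra.
by apply: Rmult_le_compat_r => //; apply: pow_incr; lra.
Qed.

Lemma anchored_epoch s st c : anchored s st c -> flagged (run_epoch s st) ->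
  desc (run_epoch s st) (anchored s.+1) c.
Proof.
move: st => [[[xt y] z] fl] q; apply: (@desc_epoch _ _ _ _ _ _ (anchored_in s xt)) => //.
- exact: anchored_step.
- exact: anchored_boundary.
Qed.

Lemma anchored_init x0 fl : finite x0 ->
  anchored 0 (x0, x0, x0, fl)
    (2 * 577 ^ 2 * 128 * (INR m * gap x0 + L * sq (vsub x0 xstar))).
Proof.
move=> fx; have g0 := gap_ge0 fx; have s0 := dot_ge0 (vsub x0 xstar); rewrite -/(sq _) in s0.
have [M64 mM] := mass_bounds 0; have [r0 r1 _ _] := rate_bounds 0.
have t1 := tau1_bd 0; have t2 := tau2_gt0; have mR := INR_gt0 m_gt0.
(* All weights sit on [x0], so the reference point equals [z] and the damped square starts at
   zero. *)
pose th0 := INR m * (tau1 0 + tau2); pose mu0 := mass 0 - 1 - th0.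
have th00 : 0 <= th0 by apply: Rmult_le_pos; lra.
have mu00 : 0 <= mu0 by rewrite /mu0 /th0; lra.
pose A := Anchor 1 (avg_weight 0) th0 mu0 (vscale mu0 x0) (mu0 * gap x0) 0.
split=> //; exists A.
  split; rewrite /A /=.
  - exact: epi_zero.
  - by have := epi_scale mu00 (epi_point fx); rewrite Rmult_1_r.
  - by lra.
  - by rewrite Rmult_0_l Rminus_0_r Rmult_1_r /avg_weight; lra.
  split=> //; last by rewrite /mu0; ring.
  split; last by apply: Rle_refl.
  by rewrite Rminus_0_r; apply: Rmult_le_compat_l; lra.
have -> : vscale (/ mass 0) (anchor_vec A x0 (@vzero d) x0) = x0.
  apply: functional_extensionality => j.
  by rewrite /anchor_vec /A /= /vadd /vscale /vzero /mu0; field; lra.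
have -> : sq (vsub x0 x0) = 0 by rewrite /sq (dotBl x0); ring.
have -> : anchor_val A x0 x0 = mass 0 * gap x0 by rewrite /anchor_val /A /= /mu0; ring.
rewrite /gain Rmult_0_l Rplus_0_r [growth 0]/=.
have mle : mass 0 <= 128 * INR m.
  have : INR m * (tau1 0 + tau2) <= INR m * 1 by apply: Rmult_le_compat_l; lra.
  by rewrite /mass; lra.
have := Rmult_le_compat_r _ _ _ g0 mle.
have : 0 <= L * sq (vsub x0 xstar) by apply: Rmult_le_pos; lra.
lra.
Qed.

(** With [q = m (tau1 + tau2) >= 1], the snapshot has weight at least [q / 64] and
    [mass s <= 128 q], so [growth s] is at least [m * horizon s ^ 2 / (256 q)]; [q] cancels in the
    product, and [64 * 256 = 16384]. *)
Lemma anchored_final s xt y z fl c : 1 <= INR m * (tau1 s + tau2) ->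
  anchored s (xt, y, z, fl) c -> INR m * horizon s ^ 2 / 16384 * gap xt <= c.
Proof.
move=> big [fxt fy [A ok le]].
have mR := INR_gt0 m_gt0; have g0 := gap_ge0 fxt; have gy0 := gap_ge0 fy.
have be0 := be_ge0 ok; have [M64 _] := mass_bounds s; have t1 := tau1_bd s.
have T2 := horizon_ge2 s; have Gm := growth_mass s; have Gg := growth_ge s.
have [e1 e2 _ [a0 _] [[th1 _] _ _]] := ok; rewrite Rminus_0_r in th1.
have t2 := tau2_gt0.
have thB : INR m * (tau1 s + tau2) / 64 <= th A.
  apply: Rle_trans th1; rewrite /Rdiv Rmult_assoc; apply: Rmult_le_compat_l; lra.
have GB : INR m * (horizon s ^ 2 / (256 * (INR m * (tau1 s + tau2)))) <= growth s.
  apply: Rle_trans Gm; apply: Rmult_le_compat_l; first lra.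
  apply: Rmult_le_compat_l; first by nra.
  by apply: Rinv_le_contravar; [lra | rewrite /mass; lra].
have prod : INR m * horizon s ^ 2 / 16384 <= growth s * th A.
  set q := INR m * (tau1 s + tau2) in big thB GB.
  have -> : INR m * horizon s ^ 2 / 16384 = INR m * (horizon s ^ 2 / (256 * q)) * (q / 64).
    by field; lra.
  apply: Rmult_le_compat => //; last lra.
  apply: Rmult_le_pos; first lra.
  by apply: Rmult_le_pos; [nra | apply: Rlt_le; apply: Rinv_0_lt_compat; lra].
apply: (Rle_trans _ (growth s * th A * gap xt)); first exact: Rmult_le_compat_r.
apply: Rle_trans le; rewrite /gain Rmult_0_l Rplus_0_r.
have G0 : 0 <= growth s by nra.
have K0 : 0 <= (growth s + INR 1 * (horizon s / mass s) - horizon s ^ 2) *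
  (3 * L * (tau1 s ^ 2 * sq (vsub z (vscale (/ mass s) (anchor_vec A y (@vzero d) xt))))).
  have ra := ratio_ge0 s.
  apply: Rmult_le_pos; first by rewrite /=; nra.
  by apply: Rmult_le_pos; [lra | apply: Rmult_le_pos; [nra | exact: dot_ge0]].
have W0 : 0 <= 3 * L * sq (vsub z xstar) by apply: Rmult_le_pos; [lra | exact: dot_ge0].
have V0 : 0 <= be A * gap y + al A * jj A + rho A.
  have := epi_ge0 e1; have := epi_ge0 e2 => h1 h2.
  have : 0 <= be A * gap y by exact: Rmult_le_pos.
  have : 0 <= al A * jj A by exact: Rmult_le_pos.
  lra.
have := Rmult_le_pos _ _ G0 V0; rewrite /anchor_val; lra.
Qed.

(** Meant for bounded [mass], when [growth] alone carries the factor [m]. The current [y] keeps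
    weight [1 - al A], at least [1 - 1 / 2 - 1 / 8]. *)
Lemma anchored_iterate s xt t y z ys fl c : (t < m)%N ->
  anchored_in s xt t.+1 (y, z, ys, fl) c -> 3 / 8 * growth s * gap y <= c.
Proof.
move=> tm [fxt fy [A ok le]].
have mR := INR_gt0 m_gt0; have g0 := gap_ge0 fxt; have gy0 := gap_ge0 fy.
have th0 := th_ge0 tm ok; have [M64 _] := mass_bounds s; have t1 := tau1_bd s.
have T2 := horizon_ge2 s; have Gg := growth_ge s.
have [e1 e2 _ [a0 [_ a1]] [_ /(_ erefl) beE _]] := ok.
have be1 : 3 / 8 <= be A by rewrite beE; rewrite /avg_weight in a1; lra.
apply: Rle_trans le.
have Gl := gain_ge s t.+1; have Gl2 := gain_ge s t.+2.
have K0 : 0 <= (gain s t.+2 - horizon s ^ 2) *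
  (3 * L * (tau1 s ^ 2 * sq (vsub z (vscale (/ mass s) (anchor_vec A y ys xt))))).
  apply: Rmult_le_pos; first by nra.
  by apply: Rmult_le_pos; [lra | apply: Rmult_le_pos; [nra | exact: dot_ge0]].
have W0 : 0 <= 3 * L * sq (vsub z xstar) by apply: Rmult_le_pos; [lra | exact: dot_ge0].
have : 3 / 8 * growth s * gap y <= gain s t.+1 * anchor_val A y xt; last lra.
rewrite (Rmult_comm (3 / 8)) Rmult_assoc; apply: Rmult_le_compat => //; first nra.
  by apply: Rmult_le_pos; lra.
have := epi_ge0 e1; have := epi_ge0 e2 => h1 h2.
have := Rmult_le_compat_r _ _ _ gy0 be1.
have : 0 <= al A * jj A by exact: Rmult_le_pos.
have : 0 <= th A * gap xt by exact: Rmult_le_pos.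
rewrite /anchor_val; lra.
Qed.

End SmallSnapshotWeight.

(** * Case analysis and the final constant *)

Lemma desc_outer_last (Q : nat -> state -> R -> Prop) (Out : state -> R -> Prop) k st c :
  (forall i st c, Q i st c -> flagged (run_epoch i st) -> desc (run_epoch i st) (Q i.+1) c) ->
  (forall st c, Q k st c -> flagged (run_epoch k st) -> desc (run_epoch k st) Out c) ->
  Q 0%N st c -> flagged (run_outer 0 k.+1 st) -> desc (run_outer 0 k.+1 st) Out c.
Proof.
move=> Hs Hl q flg.
pose Q' i := if i == k.+1 then Out else Q i.
have QE : Q' k.+1 = Out by rewrite /Q' eqxx.
have := @desc_outer Q' k.+1 0 st c; rewrite add0n QE; apply=> //.
move=> i st1 c1 /andP [_ ik]; rewrite /Q' (ltn_eqF ik) eqSS.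
by case: eqP => [->|_]; [exact: Hl | exact: Hs].
Qed.

Lemma scale_bound S E c M0 K : (0 < S)%N -> 0 <= M0 -> 0 < K ->
  INR m * INR S ^ 2 / K * E <= c * M0 -> E <= c * K / (INR m * INR S ^ 2) * M0.
Proof.
move=> S0 M00 K0 le; have mR := INR_gt0 m_gt0; have SR := INR_gt0 S0.
have p : 0 < INR m * INR S ^ 2 / K by apply: Rdiv_lt_0_compat => //; apply: Rmult_lt_0_compat => //; exact: pow_lt.
apply: (Rmult_le_reg_l _ _ _ p).
have -> : INR m * INR S ^ 2 / K * (c * K / (INR m * INR S ^ 2) * M0) = c * M0; last by [].
by field; split; [lra | split; lra].
Qed.

(** The initial factor of [anchored_init] times [65536 = 4 * 16384], where 16384 is from
    [anchored_final] and 4 from [S ^ 2 / 4 <= horizon S ^ 2]; it dominates the constants of the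
    other cases. *)
Definition rate_constant : R := 2 * 577 ^ 2 * 128 * 65536.

Lemma gap_bound S x0 : (0 < S)%N -> finite x0 ->
  flagged (run_outer 0 S (x0, x0, x0, true)) ->
  expect (run_outer 0 S (x0, x0, x0, true)) (fun st => gap (out_x st)) <=
    rate_constant / (INR m * INR S ^ 2)
    * (INR m * gap x0 + L * dot (vsub x0 xstar) (vsub x0 xstar)).
Proof.
move=> S0 fx flg; have mR := INR_gt0 m_gt0; have SR := INR_gt0 S0.
set M0 := INR m * gap x0 + _.
have M00 : 0 <= M0.
  apply: Rplus_le_le_0_compat; apply: Rmult_le_pos; try lra; first exact: gap_ge0.
  exact: dot_ge0.
set mu0 := run_outer 0 S _ in flg *.
have E0 : 0 <= expect mu0 (fun st => gap (out_x st)).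
  rewrite -(expect_const 0 (outerP 0 S (x0, x0, x0, true))).
  apply: expect_le_supp; first exact: outerP.
  by move=> st sst; apply: gap_ge0; exact: outer_finite sst.
(* Common exit of the four cases: a potential that starts at most at [c * M0] and ends with weight
   [k] on the gap. *)
have fin k c K : 0 <= c -> 0 < K -> c * K <= rate_constant ->
    INR m * INR S ^ 2 / K <= k ->
    (forall F, (forall st, F st = k * gap (out_x st)) -> expect mu0 F <= c * M0) ->
    expect mu0 (fun st => gap (out_x st)) <= rate_constant / (INR m * INR S ^ 2) * M0.
  move=> c0 K0 cK kle HF.
  apply: (Rle_trans _ (c * K / (INR m * INR S ^ 2) * M0)).
    apply: scale_bound => //.
    apply: (Rle_trans _ (k * expect mu0 (fun st => gap (out_x st)))).
      exact: Rmult_le_compat_r.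
    by rewrite -expectZ; exact: HF.
  apply: Rmult_le_compat_r => //; apply: Rmult_le_compat_r => //.
  by apply: Rlt_le; apply: Rinv_0_lt_compat; apply: Rmult_lt_0_compat => //; exact: pow_lt.
have S40 : 0 <= INR S ^ 2 / 4 by have := pow2_ge_0 (INR S); lra.
have TS : INR S ^ 2 / 4 <= horizon S ^ 2 by rewrite /horizon; nra.
have [k SE] : exists k, S = k.+1 by case: (S) S0 => // k _; exists k.
have Tk : INR S ^ 2 / 4 <= horizon k ^ 2.
  by rewrite SE S_INR /horizon; have := pos_INR k; nra.
have t2 := tau2_gt0.
(* If [tau2] is large, the snapshot weight [m * tau2 * horizon S ^ 2] of the first potential
   suffices. *)
case: (Rlt_le_dec (1 / 576) tau2) => [tbig|tsmall].
  apply: (fin (INR m * tau2 * horizon S ^ 2) 4 2304); rewrite ?/rate_constant; try lra.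
    have -> : INR m * INR S ^ 2 / 2304 = INR m * (1 / 576) * (INR S ^ 2 / 4) by field.
    apply: Rmult_le_compat => //; first lra.
    by apply: Rmult_le_compat_l; lra.
  move=> F FE; apply: (@desc_outer katyusha S 0 _ _ _ (katyusha_init _ fx) flg).
    by move=> i st c _; exact: katyusha_epoch.
  move=> [[[xt y] z] fl] c _; rewrite add0n => -[fxt fy le]; rewrite FE; apply: Rle_trans le.
  have T2 := horizon_ge2 S; have t1 := tau1_bd S.
  have : 0 <= (1 - tau1 S - tau2) * horizon S ^ 2 * gap y.
    by apply: Rmult_le_pos; [apply: Rmult_le_pos; nra | exact: gap_ge0].
  have : 0 <= 3 * L * sq (vsub z xstar) by apply: Rmult_le_pos; [lra | exact: dot_ge0].
  by rewrite [out_x _]/=; lra.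
(* If [m] is bounded, the weight of order [horizon k ^ 2] on each iterate of the last epoch
   suffices, and these iterates are averaged. *)
case: (Rlt_le_dec (INR m) 288) => [msmall|mbig].
  have T2 := horizon_ge2 k; have t1 := tau1_bd k.
  apply: (fin (horizon k ^ 2 / 5) 4 (20 * 288)); rewrite ?/rate_constant; try lra.
    have -> : INR m * INR S ^ 2 / (20 * 288) = INR m / 288 * (INR S ^ 2 / 4 / 5) by field.
    rewrite -[X in _ <= X]Rmult_1_l; apply: Rmult_le_compat; lra.
  move=> F FE; rewrite /mu0 SE; rewrite /mu0 SE in flg.
  apply: (desc_outer_last katyusha_epoch _ (katyusha_init _ fx) flg); last first.
    by move=> st c _; rewrite FE; exact.
  move=> [[[xt y] z] fl] c q flg'.
  apply: (@desc_average k xt y z fl c _ (katyusha_in k xt)) => //; first nra.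
  - exact: katyusha_step.
  - move=> t y' z' ys fl' c' tm [fxt fy' [j e le]]; apply: Rle_trans le.
    have g0 := gap_ge0 fy'; have gx := gap_ge0 fxt; have j0 := epi_ge0 e.
    have w : horizon k ^ 2 / 5 <= y_weight k t.+1 by rewrite /y_weight horizonS; nra.
    have := Rmult_le_compat_r _ _ _ g0 w.
    have : 0 <= 3 * L * sq (vsub z' xstar) by apply: Rmult_le_pos; [lra | exact: dot_ge0].
    have : 0 <= tau2 * horizon k.+1 ^ 2 * j.
      by apply: Rmult_le_pos => //; apply: Rmult_le_pos; [lra | exact: pow2_ge_0].
    have : 0 <= (INR m - INR t.+1) * (tau2 * horizon k ^ 2 * gap xt).
      have : INR t.+1 <= INR m by apply: le_INR; apply/leP.
      move=> tR; apply: Rmult_le_pos; first lra.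
      by apply: Rmult_le_pos => //; apply: Rmult_le_pos; [lra | exact: pow2_ge_0].
    lra.
  - exact: katyusha_start q.
(* The product decides which share of the anchor is read off: that of the snapshot, or, when [mass]
   is bounded, that of the iterates of the last epoch. *)
case: (Rle_lt_dec 1 (INR m * (tau1 S + tau2))) => [mt|mt].
  apply: (fin (INR m * horizon S ^ 2 / 16384) (2 * 577 ^ 2 * 128) 65536);
    rewrite ?/rate_constant; try lra.
    have -> : INR m * INR S ^ 2 / 65536 = INR m * (INR S ^ 2 / 4) / 16384 by field.
    by apply: Rmult_le_compat_r; [lra | apply: Rmult_le_compat_l; lra].
  move=> F FE; apply: (@desc_outer anchored S 0 _ _ _ (anchored_init mbig tsmall _ fx) flg).
    by move=> i st c _; exact: anchored_epoch.
  by move=> [[[xt y] z] fl] c _; rewrite add0n FE => q; exact: anchored_final q.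
have [_ _ _ t54] := tau1S k.
(* [144 = 64 * (1 + 5 / 4)], the factor 5/4 passing from index [S] to the last epoch [k]. *)
have mass_le : mass k <= 144.
  rewrite SE in mt.
  have : INR m * (tau1 k + tau2) <= INR m * (5 / 4 * (tau1 k.+1 + tau2)).
    by apply: Rmult_le_compat_l; lra.
  by rewrite /mass; lra.
have [M64 _] := mass_bounds k; have Gm := growth_mass k.
have Gg := growth_ge mbig tsmall k; have T2 := horizon_ge2 k.
apply: (fin (3 / 8 * growth k) (2 * 577 ^ 2 * 128) 3072); rewrite ?/rate_constant; try lra.
  have : INR m * (INR S ^ 2 / 4 / 288) <= growth k.
    apply: Rle_trans Gm; apply: Rmult_le_compat_l; first lra.
    apply: Rmult_le_compat; [lra | lra | lra |].
    by apply: Rinv_le_contravar; lra.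
  lra.
move=> F FE; rewrite /mu0 SE; rewrite /mu0 SE in flg.
apply: (desc_outer_last (anchored_epoch mbig tsmall) _ (anchored_init mbig tsmall _ fx) flg);
  last by move=> st c _; rewrite FE; exact.
move=> [[[xt y] z] fl] c q flg'.
apply: (@desc_average k xt y z fl c _ (anchored_in k xt)) => //; first nra.
- exact: anchored_step.
- by move=> t y' z' ys fl' c' tm q'; apply: anchored_iterate q'.
Qed.

End Convergence.

Theorem theorem4 :
  exists C : R, 0 < C /\
  forall (d n N : nat) (fs : 'I_n -> vec d -> R) (gs : 'I_n -> vec d -> vec d)
    (h : vec d -> ereal) (prox : R -> vec d -> vec d -> vec d)
    (L lam dlam : R) (b B m S : nat) (x0 xstar : vec d),
    (0 < n)%N -> (0 < N)%N -> (0 < B)%N -> (0 < m)%N -> (0 < S)%N -> (2 <= b)%N ->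
    0 < L -> 0 < lam <= 1 -> 0 <= dlam ->
    (forall i, is_gradient (fs i) (gs i)) ->
    (forall i x y, norm (vsub (gs i x) (gs i y)) <= L * norm (vsub x y)) ->
    (forall i, convex_fun (fs i)) ->
    proper_ext h -> convex_ext h -> lsc_ext h ->
    is_prox h prox ->
    is_minimizer fs h xstar ->
    h x0 <> None ->
    let zeta := INR d * lam ^ 2 / (4 * (2 ^ (b.-1) - 1) ^ 2)
                + dlam * (1 - lam) ^ 2 + 1 / (INR N * INR B) in
    let tau2 := 5 * zeta / 3 + 1 / (2 * INR B) in
    tau2 <= 1 / 2 ->
    let run := alpc_svrg N gs prox L lam tau2 dlam b B m S x0 in
    almost_surely run (fun st => out_flag st = true) ->
    almost_surely run (fun st => h (out_x st) <> None) /\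
    expect run (fun st => Pfin fs h (out_x st) - Pfin fs h xstar)
      <= C / (INR m * INR S ^ 2)
         * (INR m * (Pfin fs h x0 - Pfin fs h xstar) + L * norm (vsub x0 xstar) ^ 2).
Proof.
exists rate_constant; split; first by rewrite /rate_constant; lra.
move=> d n N fs gs h prox L lam dlam b B m S x0 xstar n0 N0 B0 m0 S0 b2 L0 lam01 dlam0
  fgrad gLip fconv _ hconv _ proxP xmin fx0 zeta tau2 tau2le run flags.
have flg := proj1 (almost_surelyP _ _) flags.
split.
  apply/almost_surelyP => st sst.
  exact: (outer_finite xstar n0 b2 L0 lam01 fconv hconv proxP m0 fx0 fx0 sst).
rewrite norm_sq.
exact: (gap_bound n0 N0 B0 b2 L0 lam01 dlam0 fgrad gLip fconv hconv proxP xmin tau2le m0 S0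
  fx0 flg).
Qed.
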